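(* Let $N\ge 1$ be an integer and let $g:\mathbb{R}\to\mathbb{R}$ satisfy: (g1) $g\in C(\mathbb{R})$; (g2) $g$ is odd; (g3) there exists $\alpha\in(0,+\infty]$ such that $g$ is positive on $(0,\alpha)$ and negative on $(\alpha,+\infty)$; and, if $N\ge 2$, also (g4) $g$ is differentiable in $0$ and $g'(0)>0$. Then, for any $\xi\in\mathbb{R}$ with $|\xi|<\alpha$, there exists an oscillating solution $u_\xi\in C^2(\mathbb{R}^N)$ of $$-\operatorname{div}\left(\frac{\nabla u}{\sqrt{1-|\nabla u|^2}}\right)=g(u)\qquad\text{in }\mathbb{R}^N$$ such that $u_\xi(0)=\xi$ and $\|u_\xi\|_{L^\infty(\mathbb{R}^N)}=|\xi|$. Moreover $u_\xi$ is periodic if $N=1$, while it is localized if $N\ge 2$.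
   Context: A solution of the equation is a function $u\in C^2(\mathbb{R}^N)$ with $|\nabla u(x)|<1$ for all $x\in\mathbb{R}^N$ that satisfies the equation pointwise in $\mathbb{R}^N$ (classical solution). A solution $u$ is called oscillating if it has an unbounded sequence of zeros. A solution $u$ is called localized if it converges to zero at infinity together with its partial derivatives up to order 2. If $\alpha=+\infty$, the interval $(\alpha,+\infty)$ in (g3) is empty. *)

(* Defs.v *)
From HB Require Import structures.
From mathcomp Require Import all_boot all_order all_algebra.
From mathcomp Require Import all_classical all_reals all_analysis.

Set Implicit Arguments.
Unset Strict Implicit.
Unset Printing Implicit Defensive.

Import Order.TTheory GRing.Theory Num.Theory.
Import numFieldNormedType.Exports.

Local Open Scope classical_set_scope.
Local Open Scope ring_scope.

(* The library norm on ['rV[R]_N] is the sup norm, hence a separate Euclidean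
   norm, for [|grad u| < 1] in particular. *)
Definition enorm (R : realType) (N : nat) (v : 'rV[R]_N) : R :=
  Num.sqrt (\sum_(i < N) v 0 i ^+ 2).

Definition pderiv (R : realType) (N : nat) (i : 'I_N) (f : 'rV[R]_N -> R)
    (x : 'rV[R]_N) : R :=
  'D_(delta_mx 0 i) f x.

Definition grad (R : realType) (N : nat) (f : 'rV[R]_N -> R)
    (x : 'rV[R]_N) : 'rV[R]_N :=
  \row_(i < N) pderiv i f x.

Definition divergence (R : realType) (N : nat) (F : 'rV[R]_N -> 'rV[R]_N)
    (x : 'rV[R]_N) : R :=
  \sum_(i < N) pderiv i (fun y => F y 0 i) x.

(* [pderiv] is total, so the existence of the partial derivatives has to be
   required separately from their continuity. *)
Definition C1 (R : realType) (N : nat) (f : 'rV[R]_N -> R) : Prop :=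
  continuous f /\
  forall i : 'I_N,
    (forall x, derivable f x (delta_mx 0 i)) /\ continuous (pderiv i f).

Definition C2 (R : realType) (N : nat) (f : 'rV[R]_N -> R) : Prop :=
  C1 f /\ forall i : 'I_N, C1 (pderiv i f).

(* Classical solution of [- div (grad u / sqrt (1 - |grad u|^2)) = g(u)]. *)
Definition is_solution (R : realType) (N : nat) (g : R -> R)
    (u : 'rV[R]_N -> R) : Prop :=
  [/\ C2 u,
      forall x, enorm (grad u x) < 1 &
      forall x,
        - divergence
            (fun y => (Num.sqrt (1 - enorm (grad u y) ^+ 2))^-1 *: grad u y) x
        = g (u x)].

Definition oscillating (R : realType) (N : nat) (u : 'rV[R]_N -> R) : Prop :=
  exists z : nat -> 'rV[R]_N,
    (forall n, u (z n) = 0) /\ (forall M : R, exists n, M < enorm (z n)).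

Definition vanishes_at_infinity (R : realType) (N : nat)
    (f : 'rV[R]_N -> R) : Prop :=
  forall e : R, 0 < e -> exists M : R, forall x, M < enorm x -> `|f x| < e.

Definition localized (R : realType) (N : nat) (u : 'rV[R]_N -> R) : Prop :=
  [/\ vanishes_at_infinity u,
      forall i, vanishes_at_infinity (pderiv i u) &
      forall i j, vanishes_at_infinity (pderiv j (pderiv i u))].

(* The library has no Lebesgue measure on ['rV[R]_N]; the L^oo norm only needs
   its null sets, which are given here by countable coverings by boxes.
   The maximum makes the volume of an empty box zero. *)
Definition box (R : realType) (N : nat) (a b : 'rV[R]_N) : set 'rV[R]_N :=
  [set x | forall i, a 0 i <= x 0 i <= b 0 i].

Definition box_volume (R : realType) (N : nat) (a b : 'rV[R]_N) : R :=
  \prod_(i < N) Num.max 0 (b 0 i - a 0 i).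

Definition lebesgue_null (R : realType) (N : nat) (A : set 'rV[R]_N) : Prop :=
  forall e : R, 0 < e ->
    exists a b : nat -> 'rV[R]_N,
      A `<=` \bigcup_k box (a k) (b k) /\
      (\sum_(0 <= k <oo) (box_volume (a k) (b k))%:E <= e%:E)%E.

(* Essential supremum of [|u|], in the form of the library's [ess_sup]. *)
Definition Linfty_norm (R : realType) (N : nat) (u : 'rV[R]_N -> R) : \bar R :=
  ereal_inf
    [set y : \bar R | lebesgue_null [set x | ~ (`|u x|%:E <= y)%E]].

(* Main.v *)
(* A radial solution u(x) = v(|x|) corresponds, with P = v' / sqrt (1 - v'^2)
   and n = N - 1, to the singular system v' = P / sqrt (1 + P^2),
   P' = - g(v) - n P / r, which is solved with g truncated outside [-xi, xi].
   As g is only continuous, solutions are limits, along an ultrafilter, of the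
   solutions of the equation in which v is delayed by 1/m; these are
   1-Lipschitz, so convergence is locally uniform. The energy
   sqrt (1 + P^2) + G(v), with G' = g, does not increase, hence |v| <= xi and
   the truncation is harmless. If N = 1, the arc of v between two
   zeros - a and a is continued by odd reflections into a periodic solution.
   If N >= 2, then g(s) >= c s near 0, so - P / v would satisfy a Riccati
   inequality with blow-up on an interval without zeros, and a perturbation of
   the energy, forced to decrease like - ln r as long as the energy is not
   close to its minimum, shows that v and P vanish at infinity. *)
Require Import Defs.
From HB Require Import structures.
From mathcomp Require Import all_boot all_order all_algebra.
From mathcomp Require Import ring lra.
From mathcomp Require Import all_classical all_reals all_analysis.
From mathcomp Require Import measurable_realfun measurable_fun_approximation.

Set Implicit Arguments.
Unset Strict Implicit.
Unset Printing Implicit Defensive.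

Import Order.TTheory GRing.Theory Num.Theory.
Import numFieldNormedType.Exports.

Local Open Scope classical_set_scope.
Local Open Scope ring_scope.

(** * Calculus on the real line *)

(** With [q = P / r] the singular term becomes [n * q], and [(r^(n+1) q)' = - r^n g(v)] makes [q],
    up to the factor [1 / (n + 1)], a weighted mean of [- g(v)], continuous up to the centre.
    Profiles live on the whole line with a parity, so that every derivative, also the one at the
    centre, is two-sided. The slope of [v] is a value of [psi], hence below 1 whatever the forcing
    is; this gives equicontinuity without a priori estimates. The delay makes each approximate
    equation explicit, so no fixed point theorem enters. No uniqueness is at hand, so evenness and
    periodicity are built into the construction. The dissipation of the energy only sees [P]; the
    perturbation [v P / r] moves half of it to [v g(v)], so that a surplus of either kinetic or
    potential energy is dissipated at a rate of order [1 / r], whose integral diverges. The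
    essential supremum reaches the peak [|u 0|] because a small cube about 0 cannot be covered by
    boxes of smaller total volume, which is proved by slicing. *)

Section Calculus.
Variable R : realType.
Implicit Types (f g : R -> R) (x a b l : R).

Lemma is_derive_quotient f x l :
  h^-1 * (f (h + x) - f x) @[h --> 0^'] --> l -> is_derive x 1 f l.
Proof.
move=> H; have H' : h^-1 *: (f (h *: 1 + x) - f x) @[h --> 0^'] --> l.
  apply: cvg_trans H; apply: near_eq_cvg; near=> h.
  by rewrite [h *: 1]mulr1.
apply: DeriveDef; last by apply: cvg_lim H' => //; exact: Rhausdorff.
by apply/cvg_ex; exists l.
Unshelve. all: by end_near. Qed.

Lemma quotient_is_derive f x l :
  is_derive x 1 f l -> h^-1 * (f (h + x) - f x) @[h --> 0^'] --> l.
Proof.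
move=> [/cvgP + <-]; rewrite -/(derive f x 1) => H.
apply: cvg_trans H; apply: near_eq_cvg; near=> h.
by rewrite [h *: 1]mulr1.
Unshelve. all: by end_near. Qed.

Lemma is_derive_add f g x a b : is_derive x 1 f a -> is_derive x 1 g b ->
  is_derive x 1 (fun y => f y + g y) (a + b).
Proof. by move=> ? ?; exact: is_deriveD. Qed.

Lemma is_derive_opp f x a : is_derive x 1 f a ->
  is_derive x 1 (fun y => - f y) (- a).
Proof. by move=> ?; exact: is_deriveN. Qed.

Lemma is_derive_sub f g x a b : is_derive x 1 f a -> is_derive x 1 g b ->
  is_derive x 1 (fun y => f y - g y) (a - b).
Proof. by move=> ? ?; exact: is_deriveB. Qed.

Lemma is_derive_mul f g x a b : is_derive x 1 f a -> is_derive x 1 g b ->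
  is_derive x 1 (fun y => f y * g y) (a * g x + f x * b).
Proof.
move=> ? ?; apply: is_derive_eq (is_deriveM _ _) _.
by rewrite /GRing.scale/= addrC mulrC [X in _ + X]mulrC addrC [a * _]mulrC mulrC addrC.
Qed.


Lemma is_derive_scale (c : R) f x a : is_derive x 1 f a ->
  is_derive x 1 (fun y => c * f y) (c * a).
Proof. by move=> fa; exact: (is_deriveZ c). Qed.

Lemma is_derive_comp f g x a b : is_derive (g x) 1 f a -> is_derive x 1 g b ->
  is_derive x 1 (fun y => f (g y)) (a * b).
Proof. by move=> ? ?; exact: (is_derive1_comp (f := f) (g := g)). Qed.

Lemma is_derive_pow n x : is_derive x 1 (fun y : R => y ^+ n) (n%:R * x ^+ n.-1).
Proof.
apply: DeriveDef; first exact: exprn_derivable.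
by rewrite exp_derive; rewrite /GRing.scale/= mulr1.
Qed.

Lemma is_derive_inv f x a : f x != 0 -> is_derive x 1 f a ->
  is_derive x 1 (fun y => (f y)^-1) (- a / f x ^+ 2).
Proof.
move=> f0 fa; apply: is_derive_eq (is_deriveV f0 fa) _.
by rewrite /GRing.scale/= mulNr mulNr mulrC.
Qed.

Lemma is_derive_sqrt f x a : 0 < f x -> is_derive x 1 f a ->
  is_derive x 1 (fun y => Num.sqrt (f y)) (a / (2 * Num.sqrt (f x))).
Proof.
move=> f0 fa; rewrite mulrC; apply: (is_derive_comp (f := Num.sqrt)) => //.
exact: is_derive1_sqrt.
Qed.

Lemma is_derive_reflect f x l : is_derive (- x) 1 f l ->
  is_derive x 1 (fun y => f (- y)) (- l).
Proof.
move=> fl; apply: is_derive_eq (is_derive_comp (g := fun y => - y) fl _) (mulrN1 l).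
Qed.

Lemma is_derive_translate f x c l : is_derive (x + c) 1 f l ->
  is_derive x 1 (fun y => f (y + c)) l.
Proof.
move=> fl; apply: is_derive_eq (is_derive_comp (g := fun y => y + c) fl _) (mulr1 l).
exact: is_derive_shift.
Qed.

Lemma is_derive_continuous f x l : is_derive x 1 f l -> {for x, continuous f}.
Proof.
by move=> [fx _]; apply: differentiable_continuous; exact/derivable1_diffP.
Qed.

(** Every difference quotient of [h] near [x] is one of [f1] or [f2], and both families tend to [l].
    This serves at seams, and with [f1 = f2] it transports a derivative along a local equality. *)
Lemma is_derive_glue f1 f2 h x l :
  is_derive x 1 f1 l -> is_derive x 1 f2 l -> h x = f1 x -> h x = f2 x ->
  (\forall y \near x, h y = f1 y \/ h y = f2 y) -> is_derive x 1 h l.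
Proof.
move=> /quotient_is_derive d1 /quotient_is_derive d2 e1 e2 near_h.
apply: is_derive_quotient; apply/cvgrPdist_lt => e e0.
move/cvgrPdist_lt/(_ e e0) : d1 => d1; move/cvgrPdist_lt/(_ e e0) : d2 => d2.
have near_h0 : \forall y \near 0^', h (y + x) = f1 (y + x) \/ h (y + x) = f2 (y + x).
  apply: cvg_within; have : (y + x) @[y --> (0:R)] --> x.
    by rewrite -[X in _ --> X]add0r; apply: cvgD; [exact: cvg_id|exact: cvg_cst].
  by move/(_ _ near_h).
near=> y.
have : h (y + x) = f1 (y + x) \/ h (y + x) = f2 (y + x) by near: y.
case=> ->; first by rewrite e1; near: y.
by rewrite e2; near: y.
Unshelve. all: by end_near. Qed.

(** The difference quotient of [t * f t] at 0 is [f t] itself. This settles the equation for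
    [P = r * q] at the centre, where [q] is only known to be continuous. *)
Lemma is_derive_id_mul0 f : {for 0, continuous f} ->
  is_derive (0 : R) 1 (fun t => t * f t) (f 0).
Proof.
move=> cf; apply: is_derive_quotient; apply/cvgrPdist_le => e e0.
move/cvgrPdist_le/(_ e e0) : cf => near_e.
near=> t; rewrite addr0 mul0r subr0 mulKf//; near: t.
  exact: nbhs_dnbhs.
exact: nbhs_dnbhs_neq.
Unshelve. all: by end_near. Qed.

Lemma is_derive_unique f x a b : is_derive x 1 f a -> is_derive x 1 f b -> a = b.
Proof. by move=> [_ <-] [_ <-]. Qed.

Lemma mean_value f df a b : a <= b ->
  (forall x, a <= x <= b -> is_derive x 1 f (df x)) ->
  exists2 c, a <= c <= b & f b - f a = df c * (b - a).
Proof.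
move=> ab fdf; have [||c] := @MVT_segment R f df a b ab.
- by move=> x /[!in_itv]/= /andP[ax xb]; apply: fdf; rewrite !ltW.
- apply: derivable_within_continuous => x /[!in_itv]/= axb.
  by have [] := fdf _ axb.
- by rewrite in_itv/= => cab ->; exists c.
Qed.

Lemma ge0_derive_homo f df a b : a <= b ->
  (forall x, a <= x <= b -> is_derive x 1 f (df x)) ->
  (forall x, a <= x <= b -> 0 <= df x) -> f a <= f b.
Proof.
move=> ab fdf df0; have [c cab e] := mean_value ab fdf.
by rewrite -subr_ge0 e mulr_ge0 ?df0 ?subr_ge0.
Qed.

Lemma derive_lower_bound f df a b (m : R) : a <= b ->
  (forall x, a <= x <= b -> is_derive x 1 f (df x)) ->
  (forall x, a <= x <= b -> m <= df x) -> f a + m * (b - a) <= f b.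
Proof.
move=> ab fdf dfm; have [c cab e] := mean_value ab fdf.
by rewrite -lerBrDl e ler_wpM2r ?dfm ?subr_ge0.
Qed.

Lemma mean_value_norm f df r (m : R) :
  (forall x, `|x| <= `|r| -> is_derive x 1 f (df x)) ->
  (forall x, `|x| <= `|r| -> `|df x| <= m) -> `|f r - f 0| <= m * `|r|.
Proof.
move=> fdf dfm; have [r0|r0] := leP 0 r.
  have [c /andP[c0 cr] ->] : exists2 c, 0 <= c <= r & f r - f 0 = df c * (r - 0).
    apply: mean_value => // x /andP[x0 xr].
    by apply: fdf; rewrite !ger0_norm.
  by rewrite subr0 normrM ler_wpM2r// dfm// !ger0_norm.
have [c /andP[c0 cr] e] : exists2 c, r <= c <= 0 & f 0 - f r = df c * (0 - r).
  apply: mean_value => [|x /andP[x0 xr]]; first exact: ltW.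
  by apply: fdf; rewrite !ler0_norm ?lerN2// ltW.
rewrite distrC e sub0r normrM normrN ler_wpM2r// dfm//.
by rewrite !ler0_norm ?lerN2// ltW.
Qed.

Lemma lipschitz1_derive f df :
  (forall x, is_derive x 1 f (df x)) -> (forall x, `|df x| <= 1) ->
  forall x y, `|f x - f y| <= `|x - y|.
Proof.
move=> fdf df1; have H x y : x <= y -> `|f x - f y| <= `|x - y|.
  move=> xy; have [c _ e] := mean_value xy (fun z _ => fdf z).
  by rewrite distrC e normrM distrC ler_piMl.
move=> x y; have [|/ltW yx] := leP x y; first exact: H.
by rewrite (distrC (f x)) (distrC x); exact: H.
Qed.

Lemma derive_eq_fun f1 f2 df :
  (forall x, is_derive x 1 f1 (df x)) -> (forall x, is_derive x 1 f2 (df x)) ->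
  f1 0 = f2 0 -> f1 =1 f2.
Proof.
move=> d1 d2 e x; apply/eqP; rewrite -subr_eq0 -normr_le0.
have := @mean_value_norm (fun x => f1 x - f2 x) (fun x => df x - df x) x 0.
rewrite e subrr subr0 mul0r; apply=> y _; last by rewrite subrr normr0.
Qed.

(** Integrating from -1 makes 0 an interior point, so that this primitive and its mirror image
    overlap on [(-1, 1)] and can be glued at 0. *)
Lemma primitive_right f : continuous f ->
  exists F : R -> R, forall x, -1 < x -> is_derive x 1 F (f x).
Proof.
move=> cf; exists (fun x => \int[lebesgue_measure]_(t in `[-1, x]) f t)%R => x x1.
have xx1 : x < x + 1 by rewrite ltrDl.
have intf : lebesgue_measure.-integrable `[-1, x + 1] (EFin \o f).
  apply: continuous_compact_integrable; first exact: segment_compact.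
  exact: continuous_subspaceT.
have [dF eF] := continuous_FTC1_closed xx1 intf x1 (cf x).
apply: DeriveDef; [exact: dF|by rewrite -derive1E; exact: eF].
Qed.

Lemma primitive_exists f : continuous f ->
  exists F : R -> R, F 0 = 0 /\ forall x, is_derive x 1 F (f x).
Proof.
move=> cf; have [F1 dF1] := primitive_right cf.
have [|F2 dF2] := @primitive_right (fun x => f (- x)).
  by move=> x; apply: continuous_comp; [exact: opp_continuous|exact: cf].
pose F x := if 0 <= x then F1 x - F1 0 else F2 0 - F2 (- x).
have d1 x : -1 < x -> is_derive x 1 (fun y => F1 y - F1 0) (f x).
  move=> x1; rewrite -[f x]subr0; apply: is_derive_sub; exact: dF1.
have d2 x : x < 1 -> is_derive x 1 (fun y => F2 0 - F2 (- y)) (f x).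
  move=> x1; rewrite -[f x]opprK -[X in is_derive _ _ _ X]sub0r; apply: is_derive_sub.
  apply: is_derive_reflect; rewrite -[X in f X]opprK; apply: dF2.
  by rewrite ltrN2.
exists F; split; first by rewrite /F lexx subrr.
move=> x; have [x0|x0|x0] := ltgtP x 0.
- apply: (is_derive_glue (d2 x _) (d2 x _)); rewrite ?/F ?(lt_geF x0)//.
  - by rewrite (lt_trans x0).
  - by rewrite (lt_trans x0).
  - by near=> y; rewrite ifF; [left|apply: lt_geF; near: y; exact: lt_nbhsl].
- apply: (is_derive_glue (d1 x _) (d1 x _)); rewrite ?/F ?(ltW x0)//.
  - by rewrite (lt_trans _ x0)// ltrN10.
  - by rewrite (lt_trans _ x0)// ltrN10.
  - by near=> y; rewrite ifT; [left|apply: ltW; near: y; exact: lt_nbhsr].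
- rewrite x0; apply: (is_derive_glue (d1 0 _) (d2 0 _)); rewrite ?/F ?lexx ?ltrN10 ?ltr01 ?subrr ?oppr0 ?subrr//.
  by near=> y; case: ifPn; [left|right].
Unshelve. all: by end_near. Qed.

(** The conditions determine the primitive uniquely ([derive_eq_fun]), so identities between
    primitives reduce to comparing derivatives. *)
Definition prim f : R -> R :=
  get [set F : R -> R | F 0 = 0 /\ forall x, is_derive x 1 F (f x)].

Lemma primP f : continuous f ->
  prim f 0 = 0 /\ forall x, is_derive x 1 (prim f) (f x).
Proof.
move=> /primitive_exists F_ex.
exact: (@getPex _ [set F : R -> R | F 0 = 0 /\ forall x, is_derive x 1 F (f x)]).
Qed.

Lemma prim0 f : continuous f -> prim f 0 = 0.
Proof. by move=> /primP[]. Qed.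

Lemma is_derive_prim f : continuous f -> forall x, is_derive x 1 (prim f) (f x).
Proof. by move=> /primP[]. Qed.

Lemma prim_reflect f (s : R) : continuous f -> (forall x, f (- x) = s * f x) ->
  forall x, prim f (- x) = - s * prim f x.
Proof.
move=> cf fs; apply: (@derive_eq_fun _ _ (fun x => - s * f x)) => [x|x|].
- rewrite mulNr -fs; apply: is_derive_reflect; exact: is_derive_prim.
- by apply: is_derive_scale; exact: is_derive_prim.
- by rewrite oppr0 prim0// mulr0.
Qed.

End Calculus.

(** * Radial averages *)

Section RadialSlope.
Variable R : realType.
Implicit Types (h k : R -> R) (s c e : R) (n : nat).

(* The solution [P] of [P' + n P / s = - h], [P 0 = 0], is [s * rslope n h s]. *)
Definition rslope n h s : R :=
  if s == 0 then - h 0 / n.+1%:R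
  else - prim (fun t => t ^+ n * h t) s / s ^+ n.+1.

Lemma continuous_pow_mul n h : continuous h -> continuous (fun t : R => t ^+ n * h t).
Proof. by move=> ch x; apply: cvgM; [exact: exprn_continuous|exact: ch]. Qed.

Lemma prim_pow_bound n h s e : continuous h ->
  (forall t, `|t| <= `|s| -> `|h t| <= e) ->
  `|prim (fun t => t ^+ n * h t) s| <= e * `|s| ^+ n.+1.
Proof.
move=> ch he; have ci := @continuous_pow_mul n h ch.
have := @mean_value_norm R (prim (fun t => t ^+ n * h t)) _ s (`|s| ^+ n * e)
  (fun x _ => is_derive_prim ci x).
rewrite prim0// subr0 exprSr mulrA [e * _]mulrC; apply=> t ts.
rewrite normrM normrX ler_pM ?exprn_ge0 ?he//.
by rewrite lerXn2r ?nnegrE.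
Qed.

Lemma rslope_bound n h s e : continuous h ->
  (forall t, `|t| <= `|s| -> `|h t| <= e) -> `|rslope n h s| <= e.
Proof.
move=> ch he; rewrite /rslope; case: eqVneq => [s0|s0].
  rewrite normrM normrN normfV [`|_%:R|]ger0_norm// ler_pdivrMr//.
  apply: le_trans (he 0 _) _; first by rewrite normr0.
  by rewrite ler_peMr ?ler1n// (le_trans _ (he 0 _))// normr0.
rewrite normrM normrN normfV normrX ler_pdivrMr ?exprn_gt0 ?normr_gt0//.
exact: prim_pow_bound.
Qed.

Lemma prim_ext h k : h =1 k -> prim h = prim k.
Proof. by move=> /funext ->. Qed.

Lemma prim_sub h k s : continuous h -> continuous k ->
  prim (fun t => h t - k t) s = prim h s - prim k s.
Proof.
move=> ch ck; have chk : continuous (fun t : R => h t - k t).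
  by move=> x; apply: cvgB; [exact: ch|exact: ck].
move: s.
apply: (@derive_eq_fun R _ _ (fun t => h t - k t)) => [x|x|].
- exact: is_derive_prim.
- by apply: is_derive_sub; exact: is_derive_prim.
- by rewrite !prim0// subrr.
Qed.

Lemma rslope_sub n h k s : continuous h -> continuous k ->
  rslope n (fun t => h t - k t) s = rslope n h s - rslope n k s.
Proof.
move=> ch ck; rewrite /rslope; case: eqVneq => [_|s0]; first by rewrite opprB -mulrBl opprK addrC.
rewrite (@prim_ext _ (fun t => t ^+ n * h t - t ^+ n * k t)) => [|t]; last by rewrite mulrBr.
rewrite prim_sub; [|exact: continuous_pow_mul..].
by rewrite -mulrBl opprB opprK addrC.
Qed.

Lemma rslope_cst n c s : rslope n (fun=> c) s = - c / n.+1%:R.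
Proof.
rewrite /rslope; case: eqVneq => // s0.
have -> : prim (fun t => t ^+ n * c) s = c / n.+1%:R * s ^+ n.+1.
  move: s {s0}.
  apply: (@derive_eq_fun R _ _ (fun t => t ^+ n * c)) => [x|x|].
  - by apply: is_derive_prim; apply: continuous_pow_mul => ?; exact: cvg_cst.
  - have -> : x ^+ n * c = c / n.+1%:R * (n.+1%:R * x ^+ n.+1.-1).
      by rewrite mulrA divfK// mulrC.
    by apply: is_derive_scale; exact: is_derive_pow.
  - rewrite prim0 ?expr0n ?mulr0//; apply: continuous_pow_mul => ?; exact: cvg_cst.
by rewrite -mulNr mulfK ?expf_neq0// mulNr.
Qed.

Lemma rslope_reflect n h s : continuous h -> (forall t, h (- t) = h t) ->
  rslope n h (- s) = rslope n h s.
Proof.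
move=> ch he; rewrite /rslope oppr_eq0; case: eqVneq => // s0.
rewrite (@prim_reflect R _ ((-1) ^+ n)).
- rewrite [(- s) ^+ _]exprNn [(-1) ^+ n.+1]exprS; field.
  by rewrite signr_eq0 expf_neq0.
- exact: continuous_pow_mul.
- by move=> x; rewrite he [(- x) ^+ _]exprNn mulrA.
Qed.

Lemma is_derive_rslope n h s : s != 0 -> continuous h ->
  is_derive s 1 (rslope n h) (- h s / s - n.+1%:R / s * rslope n h s).
Proof.
move=> s0 ch; have ci := @continuous_pow_mul n h ch.
have sn0 : s ^+ n.+1 != 0 by rewrite expf_neq0.
pose f y := - prim (fun t => t ^+ n * h t) y * (y ^+ n.+1)^-1.
have df : is_derive s 1 f (- h s / s - n.+1%:R / s * rslope n h s).
  have := is_derive_mul (is_derive_opp (is_derive_prim ci s))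
    (is_derive_inv (f := fun y => y ^+ n.+1) sn0 (is_derive_pow n.+1 s)).
  move=> /is_derive_eq; apply; rewrite /rslope (negPf s0) /=.
  set p := prim _ _; rewrite exprS; field.
  by rewrite s0 expf_neq0.
apply: (is_derive_glue df df); rewrite ?/rslope ?(negPf s0)//.
near=> y; left; rewrite ifF//; apply/negbTE; near: y.
exact: (@open_neq _ _).
Unshelve. all: by end_near. Qed.

Lemma rslope_continuous n h : continuous h -> continuous (rslope n h).
Proof.
move=> ch s; have [->|s0] := eqVneq s 0; last first.
  exact: is_derive_continuous (is_derive_rslope n s0 ch).
apply/cvgrPdist_le => e e0.
move/cvgrPdist_le/(_ e e0)/nbhs_ballP : (ch 0) => [d /= d0 hd].
near=> t.
(* The slope of a constant forcing is constant, so the increment of [rslope n h] is the slope of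
   [h 0 - h], which is small near 0. *)
have -> : rslope n h 0 = rslope n (fun=> h 0) t by rewrite rslope_cst /rslope eqxx.
rewrite -rslope_sub//; last by move=> ?; exact: cvg_cst.
apply: rslope_bound => [x|u ut]; first by apply: cvgB; [exact: cvg_cst|exact: ch].
apply: hd; rewrite /ball/= sub0r normrN (le_lt_trans ut)//.
Unshelve. all: by end_near. Qed.

Lemma is_derive_mul_rslope n h s : continuous h ->
  is_derive s 1 (fun t => t * rslope n h t) (- h s - n%:R * rslope n h s).
Proof.
move=> ch; have [->|s0] := eqVneq s 0.
  (* At the centre the equation for [q 0] is linear and gives [(n + 1) q 0 = - h 0], the value built
     into [rslope]. *)
  have -> : - h 0 - n%:R * rslope n h 0 = rslope n h 0.
    rewrite /rslope eqxx -natr1; field.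
    by rewrite natr1 pnatr_eq0.
  by apply: is_derive_id_mul0; exact: rslope_continuous.
apply: is_derive_eq (is_derive_mul (is_derive_id s 1) (is_derive_rslope n s0 ch)) _.
by rewrite -natr1; field.
Qed.

End RadialSlope.

(** * Existence for the radial equation *)

Section Psi.
Variable R : realType.
Implicit Types t x y a : R.

(* Inverse of [s |-> s / sqrt (1 - s^2)]. *)
Definition psi t : R := t / Num.sqrt (1 + t ^+ 2).

Lemma sqrt1D_gt0 t : 0 < Num.sqrt (1 + t ^+ 2).
Proof. by rewrite sqrtr_gt0 ltr_wpDr// sqr_ge0. Qed.

Lemma sqr_sqrt1D t : Num.sqrt (1 + t ^+ 2) ^+ 2 = 1 + t ^+ 2.
Proof. by rewrite sqr_sqrtr// addr_ge0// sqr_ge0. Qed.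

Lemma sqrt1D_ge1 t : 1 <= Num.sqrt (1 + t ^+ 2).
Proof. by rewrite -[leLHS]sqrtr1 ler_wsqrtr// lerDl sqr_ge0. Qed.

Lemma psi_lt1 t : `|psi t| < 1.
Proof.
have s0 := sqrt1D_gt0 t.
rewrite normrM normfV (gtr0_norm s0) ltr_pdivrMr// mul1r.
rewrite -(@ltr_pXn2r _ 2%N)// ?nnegrE ?sqrtr_ge0//.
by rewrite sqr_sqrt1D real_normK ?num_real// ltrDr.
Qed.

Lemma psi0 : psi 0 = 0.
Proof. by rewrite /psi mul0r. Qed.

Lemma psiN t : psi (- t) = - psi t.
Proof. by rewrite /psi sqrrN mulNr. Qed.

Definition dpsi t : R := (Num.sqrt (1 + t ^+ 2) ^+ 3)^-1.

Lemma is_derive_sqrt1D t : is_derive t 1 (fun y => Num.sqrt (1 + y ^+ 2)) (psi t).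
Proof.
have t0 : 0 < 1 + t ^+ 2 by rewrite ltr_wpDr// sqr_ge0.
have d : is_derive t 1 (fun y : R => 1 + y ^+ 2) (0 + 2%:R * t ^+ 1).
  exact: is_derive_add (is_derive_cst _ _ _) (is_derive_pow 2 t).
apply: is_derive_eq (is_derive_sqrt (f := fun y => 1 + y ^+ 2) t0 d) _; rewrite /psi.
have := sqrt1D_gt0 t; set w := Num.sqrt _ => w0; field.
by rewrite gt_eqF.
Qed.

Lemma is_derive_psi t : is_derive t 1 psi (dpsi t).
Proof.
have w0 := lt0r_neq0 (sqrt1D_gt0 t).
have d := is_derive_mul (is_derive_id t 1) (is_derive_inv (f := fun y => Num.sqrt (1 + y ^+ 2)) w0 (is_derive_sqrt1D t)).
apply: is_derive_eq d _; rewrite /psi /dpsi.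
have := sqr_sqrt1D t; move: w0; set w := Num.sqrt _ => w0 w2.
have -> : 1 / w + t * (- (t / w) / w ^+ 2) = (w ^+ 2 - t ^+ 2) / w ^+ 3 by field.
by rewrite w2 addrK div1r.
Qed.

Lemma dpsi_gt0 t : 0 < dpsi t.
Proof. by rewrite invr_gt0 exprn_gt0// sqrt1D_gt0. Qed.

Lemma dpsi_le1 t : dpsi t <= 1.
Proof. by rewrite invf_le1 ?exprn_gt0 ?sqrt1D_gt0// exprn_ege1// sqrt1D_ge1. Qed.

Lemma psi_continuous : continuous psi.
Proof. by move=> t; exact: is_derive_continuous (is_derive_psi t). Qed.

Lemma dpsi_continuous : continuous dpsi.
Proof.
move=> t; apply: cvgV; first by rewrite expf_neq0// gt_eqF// sqrt1D_gt0.
apply: (continuous_comp (f := fun y : R => Num.sqrt (1 + y ^+ 2)) (g := fun y => y ^+ 3)).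
  exact: is_derive_continuous (is_derive_sqrt1D t).
exact: exprn_continuous.
Qed.

Lemma psi_lipschitz x y : `|psi x - psi y| <= `|x - y|.
Proof.
apply: (lipschitz1_derive is_derive_psi) => t.
by rewrite gtr0_norm ?dpsi_gt0// dpsi_le1.
Qed.

Lemma psi_homo x y : x <= y -> psi x <= psi y.
Proof.
move=> xy; apply: (ge0_derive_homo xy (df := dpsi)) => t _.
  exact: is_derive_psi.
exact: ltW (dpsi_gt0 t).
Qed.

End Psi.

(** * Delayed approximations and their limit *)

Section Existence.
Variables (R : realType) (n : nat) (g : R -> R) (xi : R).
Hypothesis cg : continuous g.

Let flux h (s : R) : R := psi (s * rslope n h s).

Let flux_continuous h : continuous h -> continuous (flux h).
Proof.
move=> ch s; apply: (continuous_comp (f := fun s : R => s * rslope n h s) (g := @psi R)).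
  exact: is_derive_continuous (is_derive_mul_rslope n s ch).
exact: psi_continuous.
Qed.

(** Moves [t] towards the centre by [d] from either side; the result depends on [|t|] only, so the
    forcing is even. *)
Definition delay (d t : R) : R := Num.max (`|t| - d) 0.

Lemma delay_lipschitz d x y : `|delay d x - delay d y| <= `|x - y|.
Proof.
have h : `| `|x| - `|y| | <= `|x - y| by exact: ler_dist_dist.
apply: le_trans h; rewrite /delay.
case: (leP (`|x| - d) 0) => hx; case: (leP (`|y| - d) 0) => hy.
- by rewrite subrr normr0.
- by rewrite sub0r normrN (gtr0_norm hy) distrC; apply: le_trans (ler_norm _); lra.
- by rewrite subr0 (gtr0_norm hx); apply: le_trans (ler_norm _); lra.
- by have -> : `|x| - d - (`|y| - d) = `|x| - `|y| by ring.
Qed.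

Lemma delay_near d t : 0 <= d -> `|delay d t - `|t| | <= d.
Proof.
move=> d0; rewrite /delay; case: (leP (`|t| - d) 0) => h.
  by rewrite sub0r normrN normr_id; move: h; rewrite subr_le0.
by rewrite addrAC subrr sub0r normrN ger0_norm.
Qed.

Definition delayed_step (d : R) (v : R -> R) (r : R) : R :=
  xi + prim (flux (fun t => g (v (delay d t)))) r.

Definition delay_iter (d : R) (k : nat) : R -> R := iter k (delayed_step d) (fun=> xi).

Let forcing_continuous d v : continuous v -> continuous (fun t => g (v (delay d t))).
Proof.
move=> cv t.
have cd : {for t, continuous (delay d)}.
  apply/cvgrPdist_le => e e0; near=> u.
  apply: le_trans (delay_lipschitz _ _ _) _; near: u; exact: cvgr_dist_le.
apply: continuous_comp; last exact: cg.
by apply: continuous_comp; [exact: cd|exact: cv].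
Unshelve. all: by end_near. Qed.

Lemma lipschitz1_continuous (v : R -> R) :
  (forall x y, `|v x - v y| <= `|x - y|) -> continuous v.
Proof.
move=> lv t; apply/cvgrPdist_le => e e0; near=> u.
apply: le_trans (lv _ _) _; near: u; exact: cvgr_dist_le.
Unshelve. all: by end_near. Qed.

Let delayed_step_derive d v (r : R) : continuous v ->
  is_derive r 1 (delayed_step d v) (flux (fun t => g (v (delay d t))) r).
Proof.
move=> cv; rewrite -[X in is_derive _ _ _ X]add0r; apply: is_derive_add.
by apply: is_derive_prim; apply: flux_continuous; exact: forcing_continuous.
Qed.

(** The slope of every iterate is a value of [psi], so the constant 1 depends neither on [g] nor on
    [d] and [k]. *)
Lemma delay_iter_lipschitz d k x y : `|delay_iter d k x - delay_iter d k y| <= `|x - y|.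
Proof.
elim: k x y => [|k IH] x y; first by rewrite subrr normr0.
apply: (@lipschitz1_derive R _ _ (fun r => delayed_step_derive d r (lipschitz1_continuous IH))).
by move=> r; apply: ltW; exact: psi_lt1.
Qed.

Lemma delay_iter_continuous d k : continuous (delay_iter d k).
Proof. by apply: lipschitz1_continuous; exact: delay_iter_lipschitz. Qed.

Lemma delay_iter0 d k : delay_iter d k 0 = xi.
Proof.
case: k => // k; rewrite /= /delayed_step prim0 ?addr0//.
apply: flux_continuous; apply: forcing_continuous; exact: delay_iter_continuous.
Qed.


Lemma flux_close h k s e : continuous h -> continuous k ->
  (forall t, `|t| <= `|s| -> `|h t - k t| <= e) ->
  `|flux h s - flux k s| <= `|s| * e.
Proof.
move=> ch ck hk; apply: le_trans (psi_lipschitz _ _) _.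
rewrite -mulrBr normrM ler_wpM2l// -rslope_sub//; apply: rslope_bound => //.
by move=> x; apply: cvgB; [exact: ch|exact: ck].
Qed.

Lemma prim_flux_close h k r e : continuous h -> continuous k ->
  (forall t, `|t| <= `|r| -> `|h t - k t| <= e) ->
  `|prim (flux h) r - prim (flux k) r| <= `|r| * e * `|r|.
Proof.
move=> ch ck hk; have [ch' ck'] := (flux_continuous ch, flux_continuous ck).
have := @mean_value_norm R (fun x => prim (flux h) x - prim (flux k) x)
  (fun x => flux h x - flux k x) r (`|r| * e).
rewrite !prim0// !subr0; apply=> x xr.
  by apply: is_derive_sub; exact: is_derive_prim.
apply: le_trans (flux_close (e := e) ch ck _) _.
  by move=> t /le_trans; move/(_ _ xr); exact: hk.
by rewrite ler_wpM2r// (le_trans _ (hk 0 _))// normr0.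
Qed.

(** A step at radius [r] reads the previous iterate only up to radius [|r| - d], so each iteration
    settles a further length [d]. *)
Lemma delay_iter_stable d k r : 0 < d -> `|r| <= k%:R * d ->
  delay_iter d k.+1 r = delay_iter d k r.
Proof.
move=> d0; elim: k r => [|k IH] r.
  by rewrite mul0r normr_le0 => /eqP ->; rewrite !delay_iter0.
move=> rk; apply/eqP; rewrite -subr_eq0 -normr_le0.
rewrite [delay_iter d k.+2]/= [in X in _ - X]/= /delayed_step opprD addrACA subrr add0r.
(* Equality of the two primitives is obtained as closeness with error 0. *)
have := @prim_flux_close (fun t => g (delay_iter d k.+1 (delay d t)))
  (fun t => g (delay_iter d k (delay d t))) r 0.
rewrite mulr0 mul0r; apply; [exact: forcing_continuous (@delay_iter_continuous _ _)..|].
move=> t tr; rewrite IH ?subrr ?normr0//.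
rewrite /delay; case: (leP (`|t| - d) 0) => h; first by rewrite normr0 mulr_ge0// ltW.
by rewrite gtr0_norm// lerBlDr (le_trans tr)// (le_trans rk)// -natr1 mulrDl mul1r.
Qed.

Let step_size (m : nat) : R := m.+1%:R^-1.
(** By stability, [(m + 1)^2] iterations of step [1 / (m + 1)] are exact up to radius [m + 1], which
    exhausts the line. *)
Let appr m : R -> R := delay_iter (step_size m) (m.+1 ^ 2).

Let appr_eq m r : `|r| <= m.+1%:R ->
  appr m r = xi + prim (flux (fun t => g (appr m (delay (step_size m) t)))) r.
Proof.
move=> rm; rewrite -[LHS]delay_iter_stable// ?invr_gt0//.
by rewrite expnS expn1 natrM mulfK.
Qed.

(** Compactness yields a cluster point, and an ultrafilter converges to each of its cluster
    points. *)
Lemma ultra_bounded_cvg (U : set_system nat) (x : nat -> R) (B : R) :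
  UltraFilter U -> (forall m, `|x m| <= B) -> exists l : R, x m @[m --> U] --> l.
Proof.
move=> UU xB; have PU : ProperFilter U by exact: ultra_proper.
have cB : compact `[- B, B] by exact: segment_compact.
have [|l [_ cl]] := cB (x @ U) _.
  by apply: (@filterE _ U) => m; rewrite /= in_itv/= -ler_norml.
exists l => V nV; have [//|UV] := in_ultra_setVsetC (x @^-1` V) UU.
by have [y [Vy nVy]] := cl (~` V) V UV nV.
Qed.

Theorem radial_ode_exists : exists v q : R -> R,
  [/\ v 0 = xi /\ (forall r, v (- r) = v r),
      continuous q /\ (forall r, q (- r) = q r),
      forall r : R, is_derive r 1 v (psi (r * q r)) &
      forall r : R, is_derive r 1 (fun t => t * q t) (- g (v r) - n%:R * q r)].
Proof.
have [U [UU ooU]] := @ultraFilterLemma nat \oo _.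
have PU : ProperFilter U by exact: ultra_proper.
have appr_lip m x y : `|appr m x - appr m y| <= `|x - y| by exact: delay_iter_lipschitz.
(* One ultrafilter provides the limits at all radii simultaneously, in place of a diagonal
   extraction. *)
have [r|v vP] := @choice R R (fun r l => appr m r @[m --> U] --> l).
  apply: (@ultra_bounded_cvg _ _ (`|xi| + `|r|)) => m.
  have := appr_lip m r 0; rewrite /appr delay_iter0 subr0 => h.
  rewrite -[delay_iter _ _ r](subrK xi) addrC; apply: le_trans (ler_normD _ _) _.
  by rewrite lerD2l.
have v_lip x y : `|v x - v y| <= `|x - y|.
  apply/ler_addgt0Pr => e e0.
  have e2 : 0 < e / 2 by rewrite divr_gt0.
  have := vP x; move/cvgrPdist_le/(_ _ e2) => hx.
  have := vP y; move/cvgrPdist_le/(_ _ e2) => hy.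
  have [m [mx my]] := filter_ex (filterI hx hy).
  have := appr_lip m x y; rewrite /= in mx my.
  have -> : v x - v y = (v x - appr m x) + (appr m x - appr m y) - (v y - appr m y) by ring.
  move=> h; apply: le_trans (ler_normB _ _) _.
  apply: le_trans (lerD (ler_normD _ _) (lexx _)) _; lra.
have cv := lipschitz1_continuous v_lip.
(* The delayed arguments tend to [|t|], so the limit forcing involves [|t|]; that [v] is even is
   only known at the end. *)
pose h (t : R) := g (v `|t|).
have ch : continuous h.
  move=> t; apply: continuous_comp; last exact: cg.
  by apply: continuous_comp; [exact: norm_continuous|exact: cv].
have unif (A e : R) : 0 < e -> \forall m \near U, forall t : R, `|t| <= A ->
    `|g (appr m (delay (step_size m) t)) - h t| <= e.
  move=> e0.
  suff : \forall m \near U, `[- A, A] `<=`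
      [set t | `|g (appr m (delay (step_size m) t)) - h t| <= e].
    apply: filterS => m Am t tA; apply: Am; by rewrite /= in_itv/= -ler_norml.
  (* Compactness reduces uniformity to a neighbourhood of one [t]. There the pointwise convergence
     at [|t|], the delay and the move from [t] to [t'] each use a third of the continuity modulus
     [d] of [g]. *)
  apply: (proj1 (compact_near_coveringP _) (@segment_compact _ _ _) _ U
    (fun m t => `|g (appr m (delay (step_size m) t)) - h t| <= e)) => t _.
  have e2 : 0 < e / 2 by rewrite divr_gt0.
  move/cvgrPdist_le/(_ _ e2)/nbhs_ballP : (@cg (v `|t|)) => [d /= d0 gd].
  have d3 : 0 < d / 3 by rewrite divr_gt0.
  have h_near : \forall t' \near t, `|h t - h t'| <= e / 2.
    by move/cvgrPdist_le/(_ _ e2) : (ch t).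
  have v_near : \forall m \near U, `|v `|t| - appr m `|t| | < d / 3.
    by move/cvgrPdist_lt/(_ _ d3) : (vP `|t|).
  have s_near : \forall m \near U, step_size m < d / 3.
    by apply: ooU; exact: near_infty_natSinv_lt (PosNum d3).
  have t_near : \forall t' \near t, `|t - t'| < d / 3.
    exact: (nbhsx_ballx (t : R) _ d3).
  near=> t' m.
  have gv : `|g (v `|t|) - g (appr m (delay (step_size m) t'))| <= e / 2.
    apply: gd; rewrite /ball/=.
    have -> : v `|t| - appr m (delay (step_size m) t') =
        (v `|t| - appr m `|t|) + (appr m `|t| - appr m (delay (step_size m) t))
        + (appr m (delay (step_size m) t) - appr m (delay (step_size m) t')) by ring.
    have -> : d = d / 3 + d / 3 + d / 3 by field.
    apply: le_lt_trans (ler_normD _ _) _; apply: ltr_leD; last first.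
      apply: le_trans (appr_lip _ _ _) _; apply: le_trans (delay_lipschitz _ _ _) _.
      by apply: ltW; near: t'.
    apply: le_lt_trans (ler_normD _ _) _; apply: ltr_leD; first by near: m.
    apply: le_trans (appr_lip _ _ _) _; rewrite distrC.
    apply: le_trans (delay_near _ _) _; first by rewrite invr_ge0.
    by apply: ltW; near: m.
  have ht : `|h t - h t'| <= e / 2 by near: t'.
  have -> : g (appr m (delay (step_size m) t')) - h t' =
      (h t - h t') - (g (v `|t|) - g (appr m (delay (step_size m) t'))).
    by rewrite /h; ring.
  by apply: le_trans (ler_normB _ _) _; lra.
have vE r : v r = xi + prim (flux h) r.
  apply/eqP; rewrite -subr_eq0 -normr_le0; apply/ler_addgt0Pr => e e0; rewrite add0r.
  (* [prim_flux_close] multiplies the error of the forcing by [|r|^2]; the added 1 keeps the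
     denominator positive. *)
  pose e' := e / 2 / (`|r| ^+ 2 + 1).
  have r1 : 0 < `|r| ^+ 2 + 1 by rewrite ltr_wpDl// sqr_ge0.
  have e'0 : 0 < e' by rewrite !divr_gt0.
  have e2 : 0 < e / 2 by rewrite divr_gt0.
  have v_near : \forall m \near U, `|v r - appr m r| <= e / 2.
    by move/cvgrPdist_le/(_ _ e2) : (vP r).
  have r_near : \forall m \near U, `|r| <= m%:R.
    by apply: ooU; exact: nbhs_infty_ger.
  have [m [[mv mr] mu]] := filter_ex (filterI (filterI v_near r_near) (unif `|r| e' e'0)).
  have rm1 : `|r| <= m.+1%:R by rewrite (le_trans mr)// ler_nat.
  have -> : v r - (xi + prim (flux h) r) = (v r - appr m r) +
      (prim (flux (fun t => g (appr m (delay (step_size m) t)))) r - prim (flux h) r).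
    by rewrite [X in _ - X + _](appr_eq rm1); ring.
  apply: le_trans (ler_normD _ _) _.
  have -> : e = e / 2 + e / 2 by field.
  apply: lerD => //; apply: le_trans (prim_flux_close (e := e') _ ch mu) _.
    by apply: forcing_continuous; exact: delay_iter_continuous.
  rewrite mulrAC -expr2 /e' mulrA ler_pdivrMr// [leLHS]mulrC ler_wpM2l//.
    exact: ltW.
  by rewrite lerDl.
(* [h] is even by construction, hence [q] is even, the slope of [v] odd, and [v] even; then [h] is
   [g] of [v] after all. *)
have qN r : rslope n h (- r) = rslope n h r.
  by apply: rslope_reflect => // t; rewrite /h normrN.
have vN r : v (- r) = v r.
  rewrite !vE (@prim_reflect R _ (-1)) ?opprK ?mul1r//; first exact: flux_continuous.
  by move=> x; rewrite /flux qN mulNr psiN mulN1r.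
have hE r : h r = g (v r).
  by rewrite /h; case: (ger0P r) => _ //; rewrite vN.
exists v, (rslope n h); split=> [|||r].
- by split=> //; rewrite vE prim0 ?addr0//; exact: flux_continuous.
- by split=> //; exact: rslope_continuous.
- move=> r; rewrite -[X in is_derive _ _ _ X]add0r (funext vE).
  apply: is_derive_add.
  by apply: is_derive_prim; exact: flux_continuous.
- by rewrite -hE; exact: is_derive_mul_rslope.
Unshelve. all: by end_near. Qed.

End Existence.

(** * Qualitative behaviour of radial solutions *)

(** Continuity of [q] at 0 expresses regularity at the centre, and in terms of [q] the equation for
    [P = r * q] has no singular coefficient. *)
Definition radial_solution (R : realType) (n : nat) (g v q : R -> R) : Prop :=
  [/\ forall r, v (- r) = v r,
      continuous q /\ (forall r, q (- r) = q r),
      forall r : R, is_derive r 1 v (psi (r * q r)) &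
      forall r : R, is_derive r 1 (fun t => t * q t) (- g (v r) - n%:R * q r)].

(** * Sign propagation and blow-up for a Riccati inequality *)

Section RealLemmas.
Variable R : realType.

Lemma continuous_pos_tail (f : R -> R) a b : continuous f -> a <= b -> 0 < f a ->
  (forall x, a <= x <= b -> f x != 0) -> 0 < f b.
Proof.
move=> cf ab fa f0; rewrite ltNge; apply/negP => fb.
have [||c cab fc] := @IVT R f a b 0 ab.
- exact: continuous_subspaceT.
- by rewrite ge_min le_max fb (ltW fa) orbT.
- by move: cab; rewrite in_itv/= => /f0; rewrite fc eqxx.
Qed.

(** Linear growth brings [rho] above 1 at [b]. From there [- 1 / rho] lies in [[-1, 0)] but grows at
    rate at least [k], which is impossible over the length [2 / k]. *)
Lemma riccati_blowup (rho drho : R -> R) (a k : R) : 0 < k ->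
  (forall r, a <= r -> is_derive r 1 rho (drho r)) ->
  (forall r, a <= r -> k * (1 + rho r ^+ 2) <= drho r) -> False.
Proof.
move=> k0 drhoP drho_ge.
have rho_ge r : a <= r -> rho a + k * (r - a) <= rho r.
  move=> ar; apply: (derive_lower_bound ar (df := drho)) => x /andP[ax _].
    exact: drhoP.
  apply: le_trans (drho_ge _ ax); rewrite ler_peMr ?lerDl ?sqr_ge0//.
  exact: ltW.
pose b := a + (`|rho a| + 1) / k.
have ab : a <= b by rewrite lerDl divr_ge0 ?addr_ge0// ltW.
have rho1 r : b <= r -> 1 <= rho r.
  move=> br; apply: le_trans (rho_ge _ (le_trans ab br)).
  have : `|rho a| + 1 <= k * (r - a).
    by rewrite mulrC -ler_pdivrMr// lerBrDl.
  by have := ler_norm (- rho a); rewrite normrN; lra.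
pose c := b + 2 / k.
have bc : b <= c by rewrite lerDl divr_ge0// ltW.
have rho0 r : b <= r -> rho r != 0.
  by move=> /rho1 h; rewrite gt_eqF// (lt_le_trans ltr01).
have : - (rho b)^-1 + k * (c - b) <= - (rho c)^-1.
  apply: (derive_lower_bound bc (f := fun r => - (rho r)^-1) (df := fun r => - (- drho r / rho r ^+ 2))) => x /andP[bx _].
    by apply: is_derive_opp; apply: is_derive_inv; [exact: rho0|apply: drhoP; exact: le_trans bx].
  rewrite mulNr opprK ler_pdivlMr ?exprn_gt0 ?(lt_le_trans ltr01 (rho1 _ bx))//.
  apply: le_trans (drho_ge _ (le_trans ab bx)); rewrite ler_wpM2l ?(ltW k0)//.
  by rewrite lerDr.
have -> : k * (c - b) = 2 by rewrite /c addrAC subrr add0r mulrCA divff ?mulr1// gt_eqF.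
have := rho1 _ (lexx b); have := rho1 _ bc => c1 b1.
have : (rho b)^-1 <= 1 by rewrite invf_le1// (lt_le_trans ltr01).
have : 0 < (rho c)^-1 by rewrite invr_gt0 (lt_le_trans ltr01).
lra.
Qed.

End RealLemmas.

(** * Energy bounds and zeros for a forcing positive on the whole half-line *)

Section Qualitative.
Variables (R : realType) (n : nat) (g v q : R -> R).
Hypotheses (cg : continuous g) (g_odd : forall s, g (- s) = - g s)
  (g_pos : forall s, 0 < s -> 0 < g s) (sol : radial_solution n g v q)
  (v0 : 0 < v 0).

Let P (r : R) : R := r * q r.
Let G : R -> R := prim g.

Let dv (r : R) : is_derive r 1 v (psi (P r)).
Proof. by case: sol. Qed.

Let dP (r : R) : is_derive r 1 P (- g (v r) - n%:R * q r).
Proof. by case: sol. Qed.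

Let dG (s : R) : is_derive s 1 G (g s).
Proof. exact: is_derive_prim. Qed.

Let g0 : g 0 = 0.
Proof. by have := g_odd 0; rewrite oppr0; lra. Qed.

Let GN s : G (- s) = G s.
Proof.
by rewrite /G (@prim_reflect R g (-1)) ?opprK ?mul1r// => x; rewrite g_odd mulN1r.
Qed.

Let G_abs s : G `|s| = G s.
Proof. by case: (ger0P s). Qed.

Let G_homo s t : 0 <= s -> s < t -> G s < G t.
Proof.
move=> s0 st; have [c /andP[sc ct] e] := mean_value (ltW st) (fun x _ => dG x).
rewrite -subr_gt0 lt_neqAle eq_sym; apply/andP; split; last first.
  rewrite e mulr_ge0 ?subr_ge0 ?(ltW st)//.
  have [->|c0] := eqVneq c 0; first by rewrite g0.
  by apply/ltW/g_pos; rewrite lt_neqAle eq_sym c0 (le_trans s0).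
apply/eqP => GE.
(* The mean value over [[s, t]] may be attained at 0, where [g] vanishes; strictness comes from the
   right half, which lies in the positive axis. *)
have [d /andP[d1 d2] ed] : exists2 d, (s + t) / 2 <= d <= t &
    G t - G ((s + t) / 2) = g d * (t - (s + t) / 2).
  by apply: mean_value => //; lra.
have [d' /andP[d'1 d'2] ed'] : exists2 d, s <= d <= (s + t) / 2 &
    G ((s + t) / 2) - G s = g d * ((s + t) / 2 - s).
  by apply: mean_value => //; lra.
have p1 : 0 < g d * (t - (s + t) / 2) by rewrite mulr_gt0 ?g_pos//; lra.
have p2 : 0 <= g d' * ((s + t) / 2 - s).
  rewrite mulr_ge0//; last by lra.
  have [->|c0] := eqVneq d' 0; first by rewrite g0.
  by apply/ltW/g_pos; rewrite lt_neqAle eq_sym c0 (le_trans s0).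
by move: p1 p2; rewrite -ed -ed'; lra.
Qed.

Let G_le s t : 0 <= t -> G s <= G t -> `|s| <= t.
Proof. by move=> t0; rewrite leNgt -[G s]G_abs => st; rewrite leNgt; apply: contra st; exact: G_homo. Qed.

Let G_ge0 s : 0 <= G s.
Proof.
rewrite -G_abs; have [->|s0] := eqVneq s 0; first by rewrite normr0 /G prim0.
by rewrite -[leLHS](prim0 cg); apply/ltW/G_homo; rewrite ?normr_gt0.
Qed.

Let E (r : R) : R := Num.sqrt (1 + P r ^+ 2) + G (v r).

(** The terms [g(v) psi(P)] of the kinetic and the potential part cancel; only the friction
    remains. *)
Let dE (r : R) : is_derive r 1 E (- (n%:R * q r * psi (P r))).
Proof.
have -> : - (n%:R * q r * psi (P r)) =
    psi (P r) * (- g (v r) - n%:R * q r) + g (v r) * psi (P r) by ring.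
apply: is_derive_add; last exact: is_derive_comp.
apply: (is_derive_comp (f := fun y => Num.sqrt (1 + y ^+ 2))) => //.
exact: is_derive_sqrt1D.
Qed.

Lemma mul_psi_ge0 (t : R) : 0 <= t * psi t.
Proof. by rewrite mulrA divr_ge0 ?sqrtr_ge0// -expr2 sqr_ge0. Qed.

Let E_nonincr a b : 0 <= a -> a <= b -> E b <= E a.
Proof.
move=> a0 ab; rewrite -lerN2.
apply: (ge0_derive_homo ab (f := fun r => - E r)) => r /andP[ar _].
  by apply: is_derive_opp; exact: dE.
rewrite /= opprK -mulrA mulr_ge0//.
have [->|r0] := eqVneq r 0; first by rewrite /P mul0r psi0 mulr0.
have rp : 0 < r by rewrite lt_neqAle eq_sym r0 (le_trans a0).
by rewrite -(pmulr_rge0 _ rp) mulrA mul_psi_ge0.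
Qed.

Let E0 : E 0 = 1 + G (v 0).
Proof. by rewrite /E /P mul0r expr0n addr0 sqrtr1. Qed.

Let E_le r : 0 <= r -> E r <= 1 + G (v 0).
Proof. by move=> r0; rewrite -E0; exact: E_nonincr. Qed.

Lemma radial_solution_bound r : `|v r| <= v 0.
Proof.
wlog r0 : r / 0 <= r => [H|].
  have [|/ltW r0] := leP 0 r; first exact: H.
  by case: sol => vN _ _ _; rewrite -vN H// oppr_ge0.
apply: G_le; first exact: ltW.
by have := E_le r0; rewrite /E; have := sqrt1D_ge1 (P r); lra.
Qed.

Let sqrtP_le r : 0 <= r -> Num.sqrt (1 + P r ^+ 2) <= 1 + G (v 0).
Proof. by move=> /E_le; apply: le_trans; rewrite lerDl. Qed.

Let v_cont : continuous v.
Proof. by move=> r; exact: is_derive_continuous (dv r). Qed.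

(** As long as [v] is positive, [P] decreases, so beyond [r = 1] the graph of [v] stays below a line
    of slope [psi (P 1) < 0]. *)
Lemma undamped_zero : n = 0%N -> exists2 r, 0 < r & v r = 0.
Proof.
move=> n0; apply: contrapT => nz.
have v_pos r : 0 <= r -> 0 < v r.
  move=> r0; apply: (continuous_pos_tail v_cont r0 v0) => x /andP[x0 _].
  apply/eqP => vx; apply: nz; exists x => //; rewrite lt_neqAle x0 andbT.
  by apply/eqP => x00; move: v0 (congr1 v x00) => /[swap] ->; rewrite vx ltxx.
have dP' (r : R) : is_derive r 1 P (- g (v r)).
  by have := dP r; rewrite n0 mul0r subr0.
have P1 : P 1 < 0.
  have [c /andP[c0 _]] := mean_value ler01 (fun x _ => dP' x).
  rewrite {2}/P mul0r !subr0 mulr1 => ->.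
  by rewrite oppr_lt0 g_pos// v_pos.
have P_le r : 1 <= r -> P r <= P 1.
  move=> r1; rewrite -lerN2.
  apply: (ge0_derive_homo r1 (f := fun r => - P r) (df := fun r => - - g (v r))) => x /andP[x1 _].
  by rewrite opprK; apply/ltW/g_pos/v_pos; rewrite (le_trans ler01).
have psi1 : psi (P 1) < 0 by rewrite pmulr_llt0// invr_gt0 sqrt1D_gt0.
(* The radius at which the line of slope [psi (P 1)] through [(1, v 1)] reaches 0. *)
pose b := 1 + v 1 / - psi (P 1).
have b1 : 1 <= b by rewrite lerDl divr_ge0 ?oppr_ge0 ?(ltW psi1)// ltW// v_pos.
have : - v 1 + - psi (P 1) * (b - 1) <= - v b.
  apply: (derive_lower_bound b1 (f := fun r => - v r) (df := fun r => - psi (P r))) => x /andP[x1 _].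
    by apply: is_derive_opp; exact: dv.
  by rewrite lerN2 psi_homo// P_le.
have -> : - psi (P 1) * (b - 1) = v 1.
  by rewrite /b addrAC subrr add0r mulrCA divff ?mulr1// oppr_eq0 lt_eqF.
by have := v_pos b (le_trans ler01 b1); lra.
Qed.

(** * Zeros and decay when the forcing dominates a linear function *)

Section LinearLowerBound.
Variable c : R.
Hypotheses (c0 : 0 < c) (g_ge : forall s, 0 <= s <= v 0 -> c * s <= g s).

Let mul_g_ge r : c * v r ^+ 2 <= v r * g (v r).
Proof.
have vb := radial_solution_bound r.
rewrite -real_normK ?num_real//.
have -> : v r * g (v r) = `|v r| * g `|v r|.
  by case: (ger0P (v r)) => // _; rewrite g_odd mulrNN.
by rewrite expr2 mulrCA ler_wpM2l// g_ge// normr_ge0.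
Qed.

Let K := 1 + G (v 0).
Let K_ge1 : 1 <= K. Proof. by rewrite lerDl. Qed.
Let K_gt0 : 0 < K. Proof. exact: lt_le_trans ltr01 K_ge1. Qed.

(** The energy bounds the denominator of [psi (P r)] by [K], so along the solution [psi] is at least
    linear. *)
Let mul_psi_ge r : 0 <= r -> P r ^+ 2 / K <= P r * psi (P r).
Proof.
move=> r0; rewrite mulrA -expr2 ler_wpM2l ?sqr_ge0//.
by rewrite lef_pV2 ?posrE ?sqrt1D_gt0// sqrtP_le.
Qed.

(* Riccati inequality for [- P / v]. *)
Lemma unbounded_zeros A : exists2 r, A < r & v r = 0.
Proof.
apply: contrapT => nz; have v_neq0 r : A < r -> v r != 0.
  by move=> Ar; apply/eqP => vr; apply: nz; exists r.
(* [v g(v) + P psi(P)] is at least [2 k (v^2 + P^2)]. Half of this absorbs the cross term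
   [n v P / r], by [2 |P v| <= v^2 + P^2] and [n / r <= 2 k] for [r >= a]; the other half is the
   Riccati bound. *)
pose k := Num.min c K^-1 / 2.
have m0 : 0 < Num.min c K^-1 by rewrite lt_min c0 invr_gt0.
have k0 : 0 < k by rewrite divr_gt0.
pose a := Num.max (A + 1) (n%:R / (2 * k) + 1).
have Aa r : a <= r -> A < r.
  by rewrite ge_max => /andP[]; lra.
have na r : a <= r -> 0 < r /\ n%:R <= 2 * k * r.
  rewrite ge_max => /andP[_ nr].
  have n0 : 0 <= n%:R / (2 * k) by rewrite divr_ge0// mulr_ge0// ltW.
  split; first by lra.
  by rewrite [leRHS]mulrC -ler_pdivrMr ?mulr_gt0//; lra.
pose drho r := - ((- g (v r) - n%:R * q r) * (v r)^-1 + P r * (- psi (P r) / v r ^+ 2)).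
apply: (@riccati_blowup R (fun r => - (P r * (v r)^-1)) drho a k k0) => r ar.
  apply: is_derive_opp; apply: is_derive_mul; first exact: dP.
  by apply: is_derive_inv; [rewrite v_neq0// Aa|exact: dv].
have vr : v r != 0 by rewrite v_neq0// Aa.
have [r0 nr] := na r ar.
have v2 : 0 < v r ^+ 2 by rewrite exprn_even_gt0.
have -> : drho r = (v r * g (v r) + n%:R * q r * v r + P r * psi (P r)) / v r ^+ 2.
  by rewrite /drho; field.
rewrite ler_pdivlMr//.
have -> : k * (1 + (- (P r * (v r)^-1)) ^+ 2) * v r ^+ 2 = k * v r ^+ 2 + k * P r ^+ 2.
  by field.
have h1 := mul_g_ge r; have h2 := mul_psi_ge (ltW r0).
have k1 : 2 * k * v r ^+ 2 <= c * v r ^+ 2.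
  by rewrite ler_wpM2r ?sqr_ge0// /k mulrCA divff// mulr1 ge_min lexx.
have k2 : 2 * k * P r ^+ 2 <= P r ^+ 2 / K.
  by rewrite [leRHS]mulrC ler_wpM2r ?sqr_ge0// /k mulrCA divff// mulr1 ge_min lexx orbT.
have h3 : - (k * v r ^+ 2 + k * P r ^+ 2) <= n%:R * q r * v r.
  have -> : q r = P r / r by rewrite /P mulrAC divff ?mul1r// gt_eqF.
  have h4 : 2 * `|P r * v r| <= v r ^+ 2 + P r ^+ 2.
    rewrite -(real_normK (num_real (v r))) -(real_normK (num_real (P r))) normrM.
    by have := sqr_ge0 (`|v r| - `|P r|); rewrite sqrrB; lra.
  have -> : n%:R * (P r / r) * v r = n%:R / r * (P r * v r) by ring.
  have nr2 : n%:R / r <= 2 * k by rewrite ler_pdivrMr.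
  have h5 : `|n%:R / r * (P r * v r)| <= 2 * k * `|P r * v r|.
    by rewrite normrM ger0_norm ?divr_ge0 ?(ltW r0)// ler_wpM2r.
  have h6 : 2 * k * `|P r * v r| <= k * (v r ^+ 2 + P r ^+ 2).
    by rewrite [2 * k]mulrC -mulrA ler_wpM2l// ltW.
  have := ler_norm (- (n%:R / r * (P r * v r))); rewrite normrN; lra.
lra.
Qed.

Hypothesis n0 : (0 < n)%N.

Let n_gt0 : 0 < n%:R :> R. Proof. by rewrite ltr0n. Qed.

(* The functional [2 E / n + v P / r] decreases at least like [- ln r] as long
   as the energy stays away from its minimum. *)
Lemma energy_decay e : 0 < e -> exists2 A, 0 <= A & forall r, A <= r -> E r < 1 + e.
Proof.
move=> e0; apply: contrapT => nA.
have E_ge r : 0 <= r -> 1 + e <= E r.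
  move=> r0; rewrite leNgt; apply/negP => Er; apply: nA; exists r => // s rs.
  exact: le_lt_trans (E_nonincr r0 rs) Er.
(* If [|v|] is small, at least [e / 2] of the energy surplus is kinetic, and
   [w - 1 <= (w^2 - 1) / w = P psi(P)] for [w = sqrt (1 + P^2)]. Otherwise [v g(v)] is at least
   [c d^2]. *)
have [eta eta0 eta_le] : exists2 eta, 0 < eta &
    forall r, 0 <= r -> eta <= P r * psi (P r) + v r * g (v r).
  have e2 : 0 < e / 2 by rewrite divr_gt0.
  have [d d0 dG2] : exists2 d, 0 < d & forall s, `|s| < d -> G s <= e / 2.
    have cG : {for 0, continuous G} := is_derive_continuous (dG 0).
    move/cvgrPdist_le/(_ _ e2)/nbhs_ballP : cG => [d /= d0 Gd]; exists d => // s sd.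
    have := Gd s; rewrite /ball/= sub0r normrN => /(_ sd).
    by rewrite {1}/G prim0// sub0r normrN ger0_norm.
  exists (Num.min (e / 2) (c * d ^+ 2)); first by rewrite lt_min e2 mulr_gt0// exprn_gt0.
  move=> r r0; rewrite ge_min.
  have vg0 : 0 <= v r * g (v r) by apply: le_trans (mul_g_ge r); rewrite mulr_ge0 ?sqr_ge0 ?ltW.
  have [vd|vd] := ltP `|v r| d.
    apply/orP; left; have := E_ge r r0; rewrite /E; have := dG2 _ vd.
    have : Num.sqrt (1 + P r ^+ 2) - 1 <= P r * psi (P r).
      have w1 := sqrt1D_ge1 (P r); have w2 := sqr_sqrt1D (P r).
      rewrite mulrA -expr2; move: w1 w2; set w := Num.sqrt _ => w1 w2.
      have w0 : 0 < w by rewrite (lt_le_trans ltr01).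
      by rewrite ler_pdivlMr//; lra.
    lra.
  apply/orP; right; apply: (@le_trans _ _ (v r * g (v r))); last by rewrite lerDr mul_psi_ge0.
  apply: le_trans (mul_g_ge r); rewrite ler_wpM2l ?(ltW c0)// -(real_normK (num_real (v r))).
  by rewrite lerXn2r ?nnegrE// ltW.
pose C := v 0 * K.
have vP_le r : 0 <= r -> `|v r * P r| <= C.
  move=> r0; rewrite normrM ler_pM ?radial_solution_bound//.
  apply: le_trans (sqrtP_le r0).
  rewrite -(@ler_pXn2r _ 2%N)// ?nnegrE ?sqrtr_ge0//.
  by rewrite sqr_sqrt1D real_normK ?num_real// lerDr.
have C0 : 0 <= C by rewrite mulr_ge0// ltW.
(* [2 E / n] contributes [- 2 P psi(P) / r], and [v P / r] contributes [(P psi(P) - v g(v)) / r - (n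
   + 1) v P / r^2]. The sum is at most [- eta / r] up to the last term; half of [eta] pays for the
   logarithm, the other half for that term once [r >= a]. *)
pose L r := 2 / n%:R * E r + v r * P r * r^-1 + eta / 2 * ln r.
pose dL (r : R) := 2 / n%:R * - (n%:R * q r * psi (P r)) +
  ((psi (P r) * P r + v r * (- g (v r) - n%:R * q r)) * r^-1 +
   v r * P r * (- 1 / r ^+ 2)) + eta / 2 * r^-1.
pose a := Num.max 1 (2 * n.+1%:R * C / eta).
have a1 r : a <= r -> 1 <= r by rewrite ge_max => /andP[].
have L_le r : a <= r -> L r <= L a.
  move=> ar; rewrite -lerN2.
  apply: (ge0_derive_homo ar (f := fun r => - L r) (df := fun r => - dL r)) => x /andP[ax _].
    have x0 : 0 < x by rewrite (lt_le_trans ltr01)// a1.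
    apply: is_derive_opp; apply: is_derive_add.
      apply: is_derive_add; first by apply: is_derive_scale; exact: dE.
      apply: is_derive_mul; first by apply: is_derive_mul; [exact: dv|exact: dP].
      by apply: (is_derive_inv (f := id)); rewrite gt_eqF.
    by apply: is_derive_scale; exact: is_derive1_ln.
  have x1 := a1 _ ax; have x0 : 0 < x by rewrite (lt_le_trans ltr01).
  have qE : q x = P x / x by rewrite /P mulrAC divff ?mul1r// gt_eqF.
  have -> : - dL x = ((P x * psi (P x) + v x * g (v x) - eta / 2) * x +
      n.+1%:R * (v x * P x)) / x ^+ 2.
    by rewrite /dL qE -natr1; field; rewrite !gt_eqF.
  apply: divr_ge0; last exact: sqr_ge0.
  have h1 := eta_le x (ltW x0); have := vP_le x (ltW x0).
  rewrite ler_norml => /andP[h2 _].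
  have h3 : 2 * n.+1%:R * C <= eta * x.
    by rewrite [leRHS]mulrC -ler_pdivrMr//; move: ax; rewrite ge_max => /andP[].
  have h4 : n.+1%:R * - C <= n.+1%:R * (v x * P x) by rewrite ler_wpM2l.
  have h5 : eta / 2 * x <= (P x * psi (P x) + v x * g (v x) - eta / 2) * x.
    by rewrite ler_wpM2r ?(ltW x0)//; lra.
  lra.
(* At [b] the logarithmic term exceeds [L a + C], while the other two terms of [L b] are at least
   [- C]; this contradicts [L b <= L a]. *)
pose b := Num.max a (expR ((`|L a| + C + 1) / (eta / 2))).
have ab : a <= b by rewrite le_max lexx.
have b1 := a1 _ ab; have b0 : 0 < b by rewrite (lt_le_trans ltr01).
have eta2 : 0 < eta / 2 by rewrite divr_gt0.
have lnb : `|L a| + C + 1 <= eta / 2 * ln b.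
  rewrite mulrC -ler_pdivrMr// -[leLHS]expRK ler_ln ?posrE ?expR_gt0//.
  by rewrite le_max lexx orbT.
have Lb := L_le _ ab.
have : - C <= v b * P b * b^-1.
  have : `|v b * P b * b^-1| <= C.
    rewrite normrM (ger0_norm (x := b^-1)) ?invr_ge0 ?(ltW b0)//.
    rewrite ler_pdivrMr//; apply: le_trans (vP_le b (ltW b0)) _.
    by rewrite ler_peMr.
  by rewrite ler_norml => /andP[].
have : 0 <= 2 / n%:R * E b.
  by rewrite mulr_ge0 ?divr_ge0// addr_ge0 ?sqrtr_ge0.
by move: Lb; rewrite {1}/L; have := ler_norm (L a); lra.
Qed.

Lemma radial_solution_decay e : 0 < e ->
  exists A, forall r, A <= r -> `|v r| < e /\ `|r * q r| < e.
Proof.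
move=> e0.
have Ge : 0 < G e by rewrite -[ltLHS](prim0 cg); exact: G_homo.
have w0 : 0 < Num.sqrt (1 + e ^+ 2) - 1.
  by rewrite subr_gt0 -[ltLHS]sqrtr1 ltr_sqrt ?ltrDl ?exprn_gt0// ltr_wpDr// sqr_ge0.
(* The two parts of the energy have minima 1 and 0, so a surplus below this threshold bounds each of
   them separately. *)
have [|A A0 EA] := @energy_decay (Num.min (G e) (Num.sqrt (1 + e ^+ 2) - 1)).
  by rewrite lt_min Ge.
exists A => r Ar; have := EA _ Ar; rewrite -ltrBlDl lt_min => /andP[h1 h2].
have s1 := sqrt1D_ge1 (P r); have G1 := G_ge0 (v r); split.
  rewrite ltNge; apply/negP => ev; move: h1; rewrite /E.
  have : G e <= G `|v r|.
    by move: ev; rewrite le_eqVlt => /orP[/eqP ->//|ev]; apply/ltW/G_homo; rewrite ?(ltW e0).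
  rewrite G_abs; lra.
rewrite -/(P r) ltNge; apply/negP => eP; move: h2; rewrite /E.
have : Num.sqrt (1 + e ^+ 2) <= Num.sqrt (1 + P r ^+ 2).
  rewrite ler_wsqrtr// lerD2l -(real_normK (num_real (P r))).
  by rewrite lerXn2r ?nnegrE ?(ltW e0).
lra.
Qed.

End LinearLowerBound.

End Qualitative.

(** * Existence of oscillating profiles *)

Section Fold.
Variables (R : realType) (a : R).
Hypothesis a0 : 0 < a.
Implicit Types (f df : R -> R) (r : R) (k : int).

(* Successive odd reflections of [f] restricted to [-a, a] about [a + 2 a k]. *)
Definition odd_fold f r : R :=
  let k := Num.floor ((r + a) / (2 * a)) in (-1) ^ k * f (r - 2 * a * k%:~R).

Let signS k : (-1) ^ (k + 1) = - (-1) ^ k :> R.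
Proof. by rewrite exprzDr ?unitrN1// expr1z mulrN1. Qed.

Let sign_cases k : (-1) ^ k = 1 :> R \/ (-1) ^ k = -1 :> R.
Proof.
case: k => m; rewrite ?NegzE -?exprnP -?exprnN -signr_odd.
  by case: odd; [right|left].
by case: odd; [right; rewrite expr1 invrN1|left; rewrite expr0 invr1].
Qed.

Let signN k : (-1) ^ (- k) = (-1) ^ k :> R.
Proof. by rewrite -invr_expz; case: (sign_cases k) => ->; rewrite ?invr1 ?invrN1. Qed.

(** The cell is closed: at its right end the floor has already passed to [k + 1], and
    [f (- a) = - f a] reconciles the two formulas. *)
Lemma odd_foldE f r k : f (- a) = - f a -> `|r - 2 * a * k%:~R| <= a ->
  odd_fold f r = (-1) ^ k * f (r - 2 * a * k%:~R).
Proof.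
move=> fa; rewrite ler_norml => /andP[k1 k2].
have a2 : 0 < 2 * a by rewrite mulr_gt0.
rewrite /odd_fold; have [rk|rk] := ltP ((r + a) / (2 * a)) (k + 1)%:~R.
  by rewrite (@floor_def _ _ k)// rk andbT ler_pdivlMr//; lra.
have {}rk : r = a + 2 * a * k%:~R.
  by move: rk; rewrite ler_pdivlMr// intrD; lra.
have -> : (r + a) / (2 * a) = (k + 1)%:~R by rewrite rk intrD; field; rewrite gt_eqF.
rewrite intrKfloor signS rk addrK intrD.
have -> : a + 2 * a * k%:~R - 2 * a * (k%:~R + 1%:~R) = - a by ring.
by rewrite fa mulrNN.
Qed.

Lemma odd_fold_index r : exists k, - a <= r - 2 * a * k%:~R < a.
Proof.
have a2 : 0 < 2 * a by rewrite mulr_gt0.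
exists (Num.floor ((r + a) / (2 * a))); set k := Num.floor _.
have := floor_itv ((r + a) / (2 * a)); rewrite -/k.
by rewrite ler_pdivlMr// ltr_pdivrMr// intrD => /andP[]; lra.
Qed.

Lemma odd_fold_reflect f s r : f (- a) = - f a -> (forall x, f (- x) = s * f x) ->
  odd_fold f (- r) = s * odd_fold f r.
Proof.
move=> fa fs; have [k /andP[k1 k2]] := odd_fold_index r.
rewrite (@odd_foldE f (- r) (- k))//; last first.
  by rewrite intrN mulrN opprK addrC ler_norml; lra.
rewrite (@odd_foldE f r k)//; last by rewrite ler_norml; lra.
have -> : - r - 2 * a * (- k)%:~R = - (r - 2 * a * k%:~R) by rewrite intrN; ring.
by rewrite fs signN mulrCA.
Qed.

(** A shift by [2 * a] reverses the sign, so two of them are needed. *)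
Lemma odd_fold_periodic f r : f (- a) = - f a ->
  odd_fold f (r + 4 * a) = odd_fold f r.
Proof.
move=> fa; have [k /andP[k1 k2]] := odd_fold_index r.
have e : r + 4 * a - 2 * a * (k + 1 + 1)%:~R = r - 2 * a * k%:~R.
  by rewrite !intrD; ring.
rewrite (@odd_foldE f _ (k + 1 + 1))//; last by rewrite e ler_norml; lra.
rewrite (@odd_foldE f r k)//; last by rewrite ler_norml; lra.
by rewrite e !signS opprK.
Qed.

Lemma odd_fold_comp f (g : R -> R) r : (forall x, g (- x) = - g x) ->
  odd_fold (fun x => g (f x)) r = g (odd_fold f r).
Proof.
move=> go; rewrite /odd_fold; set k := Num.floor _.
by case: (sign_cases k) => ->; rewrite ?mul1r// !mulN1r go.
Qed.

Lemma odd_fold_norm f r : exists x, `|odd_fold f r| = `|f x|.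
Proof.
have [k _] := odd_fold_index r; rewrite /odd_fold; set m := Num.floor _.
exists (r - 2 * a * m%:~R); rewrite normrM.
by case: (sign_cases m) => ->; rewrite ?normrN normr1 mul1r.
Qed.

Lemma odd_fold_id f r : f (- a) = - f a -> `|r| <= a -> odd_fold f r = f r.
Proof.
by move=> fa ra; rewrite (@odd_foldE f r 0)// ?mulr0 ?subr0// expr0z mul1r.
Qed.

Lemma is_derive_odd_fold f df r : (forall x : R, is_derive x 1 f (df x)) ->
  f (- a) = - f a -> df (- a) = - df a -> is_derive r 1 (odd_fold f) (odd_fold df r).
Proof.
move=> fdf fa dfa; have [k /andP[k1 k2]] := odd_fold_index r.
pose piece m y := (-1) ^ m * f (y + - (2 * a * m%:~R)).
have dpiece m : `|r - 2 * a * m%:~R| <= a -> is_derive r 1 (piece m) (odd_fold df r).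
  move=> rm; rewrite (odd_foldE dfa rm); apply: is_derive_scale.
  by apply: is_derive_translate; exact: fdf.
have fpiece m y : `|y - 2 * a * m%:~R| <= a -> odd_fold f y = piece m y.
  by move=> ym; rewrite (odd_foldE fa ym).
have rk : `|r - 2 * a * k%:~R| <= a by rewrite ler_norml; lra.
(* The left end of cell [k] is also the right end of cell [k - 1]; both pieces have the derivative
   [odd_fold df r] there, since [df] satisfies the same matching condition as [f]. *)
move: k1; rewrite le_eqVlt => /orP[/eqP k1|k1].
  have k'E : (k - 1)%:~R = k%:~R - 1 :> R by rewrite intrB.
  have rk' : `|r - 2 * a * (k - 1)%:~R| <= a by rewrite k'E ler_norml; lra.
  apply: (is_derive_glue (dpiece _ rk) (dpiece _ rk')); [exact: fpiece..|].
  near=> y; have [yk|yk] := leP (- a) (y - 2 * a * k%:~R); [left|right]; apply: fpiece.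
    rewrite ler_norml yk/=.
    have : y < r + a by near: y; apply: lt_nbhsl; lra.
    by lra.
  rewrite k'E ler_norml.
  have : r - a < y by near: y; apply: lt_nbhsr; lra.
  by lra.
apply: (is_derive_glue (dpiece _ rk) (dpiece _ rk)); [exact: fpiece..|].
near=> y; left; apply: fpiece; rewrite ler_norml.
have : y < 2 * a * k%:~R + a by near: y; apply: lt_nbhsl; lra.
have : 2 * a * k%:~R - a < y by near: y; apply: lt_nbhsr; lra.
by lra.
Unshelve. all: by end_near. Qed.

End Fold.

(** * Profiles of prescribed height *)

Section Profile.
Variables (R : realType) (n : nat).
Implicit Types g v P dP q : R -> R.

(* [P] stands for [v' / sqrt (1 - v'^2)] and [n] for [N - 1]. *)
Definition radial_profile g v P dP : Prop :=
  [/\ (forall r, v (- r) = v r) /\ (forall r, P (- r) = - P r),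
      (forall r : R, is_derive r 1 v (psi (P r))) /\
      (forall r : R, is_derive r 1 P (dP r)),
      continuous dP,
      forall r, r != 0 -> dP r = - g (v r) - n%:R * (P r / r) &
      n.+1%:R * dP 0 = - g (v 0)].

Definition decaying (f : R -> R) : Prop :=
  forall e, 0 < e -> exists A, forall r, A <= r -> `|f r| < e.

Lemma radial_profile_opp g v P dP : (forall s, g (- s) = - g s) ->
  radial_profile g v P dP ->
  radial_profile g (fun r => - v r) (fun r => - P r) (fun r => - dP r).
Proof.
move=> go [[ve Po] [dv dP'] cdP eq eq0]; split.
- by split=> r; rewrite ?ve ?Po.
- split=> r; last exact: is_derive_opp.
  by rewrite psiN; exact: is_derive_opp.
- by move=> r; apply: cvgN; exact: cdP.
- by move=> r r0; rewrite eq// go; ring.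
- by rewrite mulrN eq0 go.
Qed.

Lemma profile_of_solution g v q : continuous g -> radial_solution n g v q ->
  radial_profile g v (fun r => r * q r) (fun r => - g (v r) - n%:R * q r).
Proof.
move=> cg [ve [cq qe] dv dP].
have cv : continuous v by move=> r; exact: is_derive_continuous (dv r).
split=> // [||r r0|].
- by split=> // r; rewrite qe mulNr.
- move=> r; apply: cvgB; first by apply: cvgN; apply: continuous_comp; [exact: cv|exact: cg].
  by apply: cvgM; [exact: cvg_cst|exact: cq].
- by rewrite [r * _]mulrC mulfK.
- have e := is_derive_unique (is_derive_id_mul0 (cq 0)) (dP 0).
  by rewrite -e -natr1 mulrDl mul1r {2}e; ring.
Qed.

(** Near 0 the difference quotient exceeds [g'(0) / 2]; on the remaining compact interval [g] has a
    positive minimum, and [s <= xi] turns it into a linear bound. *)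
Lemma linear_lower_bound g xi : continuous g -> 0 < xi ->
  (forall s, 0 < s <= xi -> 0 < g s) -> g 0 = 0 ->
  derivable g 0 1 -> 0 < derive1 g 0 ->
  exists2 c, 0 < c & forall s, 0 <= s <= xi -> c * s <= g s.
Proof.
move=> cg xi0 g_pos g0 dg dg0; set l := derive1 g 0.
have gl : is_derive (0 : R) 1 g l by apply: DeriveDef => //; rewrite -derive1E.
have l2 : 0 < l / 2 by rewrite divr_gt0.
have : \forall h \near (0 : R)^', `|l - h^-1 * (g (h + 0) - g 0)| < l / 2.
  by move/quotient_is_derive/cvgrPdist_lt : gl; apply.
move=> /nbhs_ballP[d /= d0 hd].
have near0 s : 0 < s -> s < d -> l / 2 * s <= g s.
  move=> s0 sd; have := hd s; rewrite /ball/= sub0r normrN gtr0_norm// => /(_ sd).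
  rewrite gt_eqF// addr0 g0 subr0 => /(_ isT) h.
  rewrite -ler_pdivlMr// [g s / s]mulrC.
  by have := ltr_normlW h; lra.
pose d' := Num.min (d / 2) xi.
have d'0 : 0 < d' by rewrite lt_min divr_gt0.
have d'xi : d' <= xi by rewrite ge_min lexx orbT.
have [|m m_in m_min] := @EVT_min R g d' xi d'xi; first exact: continuous_subspaceT.
move: m_in; rewrite in_itv/= => /andP[m1 m2].
have gm : 0 < g m by rewrite g_pos// m2 (lt_le_trans d'0).
exists (Num.min (l / 2) (g m / xi)); first by rewrite lt_min l2 divr_gt0.
move=> s /andP[]; rewrite le_eqVlt => /orP[/eqP <-|s0 sxi]; first by rewrite mulr0 g0.
have [sd|sd] := ltP s d'.
  apply: le_trans (near0 _ s0 _); first by rewrite ler_wpM2r ?ge_min ?lexx// ltW.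
  by move: sd; rewrite lt_min => /andP[]; lra.
apply: le_trans (m_min s _); last by rewrite in_itv/= sd.
apply: (@le_trans _ _ (g m / xi * s)).
  by rewrite ler_wpM2r ?ge_min ?lexx ?orbT// ltW.
by rewrite mulrAC -mulrA ler_piMr ?(ltW gm)// ler_pdivrMr// mul1r.
Qed.

Theorem oscillating_profile_exists g xi : 0 < xi -> continuous g ->
  (forall s, g (- s) = - g s) -> (forall s, 0 < s <= xi -> 0 < g s) ->
  ((0 < n)%N -> derivable g 0 1 /\ 0 < derive1 g 0) ->
  exists v P dP,
    [/\ radial_profile g v P dP,
        v 0 = xi /\ (forall r, `|v r| <= xi),
        forall A, exists2 r, A < r & v r = 0,
        n = 0%N -> exists2 T, 0 < T & forall r, v (r + T) = v r &
        (0 < n)%N -> [/\ decaying v, decaying P & decaying dP]].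
Proof.
move=> xi0 cg go gp g4; pose clamp (s : R) : R := Num.max (- xi) (Num.min xi s).
have g0 : g 0 = 0 by have := go 0; rewrite oppr0; lra.
have clampE s : `|s| <= xi -> clamp s = s.
  by rewrite ler_norml => /andP[s1 s2]; rewrite /clamp min_r// max_r.
have clampN s : clamp (- s) = - clamp s.
  rewrite /clamp; case: (leP xi s) => h1; case: (leP xi (- s)) => h2.
  - by exfalso; lra.
  - by rewrite max_l ?max_r; lra.
  - by rewrite max_r ?max_l ?opprK; lra.
  - by rewrite !max_r; lra.
have clamp_pos s : 0 < s -> 0 < clamp s <= xi.
  move=> s0; rewrite /clamp lt_max lt_min xi0 s0 orbT/= ge_max ge_min lexx.
  by rewrite andbT; lra.
have c_clamp : continuous clamp.
  have -> : clamp = (fun=> - xi) \max ((fun=> xi) \min id) by [].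
  move=> s; apply: continuous_max; first exact: cvg_cst.
  by apply: continuous_min; [exact: cvg_cst|exact: cvg_id].
(* Clamping the argument extends [g] by the constants [g xi] and [- g xi], so [gc] is positive on
   the whole positive axis, as the energy argument requires. *)
pose gc s := g (clamp s).
have cgc : continuous gc.
  by move=> s; apply: continuous_comp; [exact: c_clamp|exact: cg].
have gcN s : gc (- s) = - gc s by rewrite /gc clampN go.
have gc_pos s : 0 < s -> 0 < gc s by move=> /clamp_pos; exact: gp.
have gcE s : `|s| <= xi -> gc s = g s by move=> ?; rewrite /gc clampE.
have [v [q [[v0 ve] [cq qe] dv dP]]] := @radial_ode_exists R n gc xi cgc.
have sol : radial_solution n gc v q by [].
have v0_gt0 : 0 < v 0 by rewrite v0.
have v_le r : `|v r| <= xi.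
  by rewrite -v0; exact: (radial_solution_bound cgc gcN gc_pos sol v0_gt0).
have cv : continuous v by move=> r; exact: is_derive_continuous (dv r).
pose P r := r * q r; pose dP' r := - g (v r) - n%:R * q r.
have prof : radial_profile g v P dP'.
  have := profile_of_solution cgc sol; rewrite -/P.
  have -> : (fun r => - gc (v r) - n%:R * q r) = dP'.
    by apply/funext => r; rewrite gcE.
  by move=> [? ? ? h1 h2]; split=> // [r r0|]; [rewrite h1// gcE|rewrite h2 gcE].
have [n0|n0] := posnP n; last first.
  have [dg dg0] := g4 n0.
  have [c c0 gc_ge] := linear_lower_bound cg xi0 gp g0 dg dg0.
  have gcc s : 0 <= s <= v 0 -> c * s <= gc s.
    rewrite v0 => /andP[s0 sxi]; rewrite gcE ?ger0_norm//.
    by rewrite gc_ge// s0.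
  have decay e : 0 < e -> exists A, forall r, A <= r -> `|v r| < e /\ `|P r| < e.
    exact: (radial_solution_decay cgc gcN gc_pos sol v0_gt0 c0 gcc n0).
  have decay_v : decaying v.
    by move=> e /decay[A h]; exists A => r /h[].
  have decay_P : decaying P.
    by move=> e /decay[A h]; exists A => r /h[].
  exists v, P, dP'; split=> // [||_].
  - exact: (unbounded_zeros cgc gcN gc_pos sol v0_gt0 c0 gcc).
  - by move=> n00; rewrite n00 in n0.
  - split=> // e e0.
    have e2 : 0 < e / 2 by rewrite divr_gt0.
    have := cg 0 => /cvgrPdist_lt/(_ _ e2)/nbhs_ballP[d /= d0 gd].
    have [A1 h1] := decay_v _ d0.
    have en0 : 0 < e / (2 * n.+1%:R) by rewrite divr_gt0 ?mulr_gt0.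
    have [A2 h2] := decay_P _ en0.
    (* Beyond radius 1, [|q| <= |P|], so both terms of [- g(v) - n q] decay. *)
    exists (Num.max 1 (Num.max A1 A2)) => r; rewrite !ge_max => /and3P[r1 rA1 rA2].
    have gv : `|g (v r)| < e / 2.
      have := gd (v r); rewrite /ball/= sub0r normrN g0 sub0r normrN; apply; exact: h1.
    have r0 : 0 < r by rewrite (lt_le_trans ltr01).
    have qr : `|q r| <= `|P r|.
      by rewrite /P normrM (gtr0_norm r0) ler_peMl.
    apply: le_lt_trans (ler_normB _ _) _; rewrite normrN normrM normr_nat.
    have : n%:R * `|q r| <= n.+1%:R * `|P r|.
      by rewrite ler_pM// ler_nat.
    have : n.+1%:R * `|P r| < e / 2.
      have := h2 r rA2; rewrite ltr_pdivlMr ?mulr_gt0// => h3.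
      have := h3; rewrite mulrCA mulrC [_ * 2]mulrC -/(n.+1%:R * _); lra.
    lra.
(* Only the arc on [[-a, a]] is kept. With [v a = 0] and the parities, [v], [psi (P)], [P] and [dP']
   all satisfy the matching condition at [a], so the folded triple is again a profile. *)
have [a a0 va] := undamped_zero gc_pos sol v0_gt0 n0.
case: (prof) => [[_ PN] [dv' dPP] cdP eq eq0].
have vaN : v (- a) = - v a by rewrite ve va oppr0.
have PaN : P (- a) = - P a by rewrite PN.
have psiaN : psi (P (- a)) = - psi (P a) by rewrite PaN psiN.
have dPE r : dP' r = - g (v r) by rewrite /dP' n0 mul0r subr0.
have dPaN : dP' (- a) = - dP' a by rewrite !dPE ve va g0 !oppr0.
have foldg r : odd_fold a (fun x => - g (v x)) r = - g (odd_fold a v r).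
  apply: (@odd_fold_comp R a v (fun s => - g s)) => x; by rewrite go.
have dPfold r : odd_fold a dP' r = - g (odd_fold a v r).
  by rewrite -foldg; congr odd_fold; apply/funext.
exists (odd_fold a v), (odd_fold a P), (odd_fold a dP'); split.
- split.
  + split=> r; first by rewrite (@odd_fold_reflect _ _ a0 _ 1)// ?mul1r// => x; rewrite mul1r.
    by rewrite (@odd_fold_reflect _ _ a0 _ (-1))// ?mulN1r// => x; rewrite mulN1r PN.
  + split=> r; last exact: is_derive_odd_fold.
    rewrite -(@odd_fold_comp R a P (@psi R)) => [|x]; last exact: psiN.
    exact: is_derive_odd_fold.
  + move=> r; rewrite (funext dPfold).
    apply: cvgN; apply: continuous_comp; last exact: cg.
    exact: is_derive_continuous (is_derive_odd_fold a0 r dv vaN psiaN).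
  + by move=> r r0; rewrite dPfold n0 mul0r subr0.
  + by rewrite dPfold n0 mul1r.
- split=> [|r]; first by rewrite odd_fold_id// normr0 ltW.
  by have [x ->] := odd_fold_norm a0 v r.
- move=> A; pose m := Num.bound (`|A| / (4 * a)); exists (a + (4 * a) *+ m).
    have a4 : 0 < 4 * a by rewrite mulr_gt0.
    have : `|A| / (4 * a) < m%:R by rewrite archi_boundP// divr_ge0// ltW.
    by rewrite ltr_pdivrMr// mulr_natl; have := ler_norm A; lra.
  rewrite (@periodicn _ _ (odd_fold a v)); last by move=> r; exact: odd_fold_periodic.
  by rewrite odd_fold_id// gtr0_norm.
- move=> _; exists (4 * a); first by rewrite mulr_gt0.
  by move=> r; exact: odd_fold_periodic.
- by [].
Qed.

End Profile.

(** * Radial functions on the space of row vectors *)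

Section Radial.
Variables (R : realType) (N : nat).
Implicit Types (x y : 'rV[R]_N) (i j : 'I_N) (f h w dw v dv : R -> R).

Lemma enorm_ge0 x : 0 <= enorm x.
Proof. exact: sqrtr_ge0. Qed.

Lemma sum_sqr_ge0 x : 0 <= \sum_(i < N) x 0 i ^+ 2.
Proof. by apply: sumr_ge0 => i _; exact: sqr_ge0. Qed.

Lemma sqr_enorm x : enorm x ^+ 2 = \sum_(i < N) x 0 i ^+ 2.
Proof. by rewrite sqr_sqrtr// sum_sqr_ge0. Qed.

Lemma coord_le_enorm x i : `|x 0 i| <= enorm x.
Proof.
rewrite -(@ler_pXn2r _ 2%N)// ?nnegrE ?enorm_ge0// sqr_enorm real_normK ?num_real//.
by rewrite (bigD1 i)//= lerDl sumr_ge0// => k _; exact: sqr_ge0.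
Qed.

Lemma enorm0 : enorm (0 : 'rV[R]_N) = 0.
Proof.
rewrite /enorm big1 ?sqrtr0// => i _.
by rewrite mxE expr0n.
Qed.

Lemma enorm_eq0 x : (enorm x == 0) = (x == 0).
Proof.
apply/eqP/eqP => [x0|->]; last exact: enorm0.
apply/rowP => i; rewrite mxE; apply/eqP; rewrite -normr_le0 -x0.
exact: coord_le_enorm.
Qed.

Lemma enorm_gt0 x : x != 0 -> 0 < enorm x.
Proof. by move=> x0; rewrite lt_neqAle enorm_ge0 eq_sym enorm_eq0 x0. Qed.

Lemma enormZ (c : R) x : enorm (c *: x) = `|c| * enorm x.
Proof.
rewrite /enorm -sqrtr_sqr -sqrtrM ?sqr_ge0//; congr Num.sqrt.
by rewrite mulr_sumr; apply: eq_bigr => i _; rewrite mxE exprMn.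
Qed.

Lemma enorm_delta j : enorm (delta_mx 0 j : 'rV[R]_N) = 1.
Proof.
rewrite /enorm (bigD1 j)//= big1 => [|i ij]; last by rewrite mxE (negPf ij) andbF expr0n.
by rewrite mxE !eqxx expr1n addr0 sqrtr1.
Qed.

Lemma row_continuousD (F G : 'rV[R]_N -> R) x : {for x, continuous F} ->
  {for x, continuous G} -> {for x, continuous (fun y => F y + G y)}.
Proof. exact: continuousD. Qed.

Lemma row_continuousP (F : 'rV[R]_N -> R) x :
  (forall e, 0 < e -> \forall y \near x, `|F x - F y| <= e) <-> {for x, continuous F}.
Proof.
split=> [H|cF]; first by apply/(@cvgrPdist_le _ _ _ (nbhs x) (nbhs_filter x)).
by move/(@cvgrPdist_le _ _ _ (nbhs x) (nbhs_filter x)) : cF.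
Qed.

Lemma enorm_continuous : continuous (@enorm R N).
Proof.
move=> x; apply: continuous_comp; last exact: sqrt_continuous.
rewrite /index_enum; move: (Finite.enum _) => s; elim: s => [|i s IH].
  rewrite (_ : (fun y : 'rV[R]_N => _) = fun=> 0); first exact: cst_continuous.
  by apply/funext => y; rewrite big_nil.
rewrite (_ : (fun y : 'rV[R]_N => _) =
    fun y => y 0 i * y 0 i + \sum_(k <- s) y 0 k ^+ 2).
  by apply: row_continuousD => //; apply: continuousM; exact: coord_continuous.
by apply/funext => y; rewrite big_cons.
Qed.

Lemma line_coord x i j (t : R) :
  (t *: delta_mx 0 j + x) 0 i = t * (i == j)%:R + x 0 i.
Proof. by rewrite !mxE eqxx. Qed.

Lemma enorm_line x j (t : R) :
  enorm (t *: delta_mx 0 j + x) = Num.sqrt (enorm x ^+ 2 + (2 * x 0 j) * t + t ^+ 2).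
Proof.
rewrite sqr_enorm; congr Num.sqrt.
rewrite (bigD1 j)//= [in RHS](bigD1 j)//= line_coord eqxx mulr1.
rewrite [in LHS](eq_bigr (fun i => x 0 i ^+ 2)); first by ring.
by move=> i ij; rewrite line_coord (negPf ij) mulr0 add0r.
Qed.

Lemma is_derive_line (F : 'rV[R]_N -> R) x (u : 'rV[R]_N) (l : R) :
  is_derive (0 : R) 1 (fun t => F (t *: u + x)) l -> is_derive x u F l.
Proof.
move=> /quotient_is_derive; rewrite scale0r add0r => H.
have {}H : h^-1 *: ((F \o shift x) (h *: u) - F x) @[h --> 0^'] --> l.
  apply: cvg_trans H; apply: near_eq_cvg; near=> h.
  by rewrite /= addr0.
apply: DeriveDef; last by apply: cvg_lim H => //; exact: Rhausdorff.
by apply/cvg_ex; exists l.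
Unshelve. all: by end_near. Qed.

Lemma is_derive_enorm_line x j : x != 0 ->
  is_derive (0 : R) 1 (fun t => enorm (t *: delta_mx 0 j + x)) (x 0 j / enorm x).
Proof.
move=> x0; have r0 := enorm_gt0 x0.
rewrite (funext (enorm_line x j)).
have d : is_derive (0 : R) 1
    (fun t => enorm x ^+ 2 + (2 * x 0 j) * t + t ^+ 2) (0 + 2 * x 0 j * 1 + 2%:R * 0 ^+ 1).
  apply: is_derive_add; last exact: is_derive_pow.
have p : 0 < enorm x ^+ 2 + (2 * x 0 j) * 0 + 0 ^+ 2.
  by rewrite mulr0 expr0n !addr0 exprn_gt0.
apply: is_derive_eq (is_derive_sqrt
  (f := fun t => enorm x ^+ 2 + (2 * x 0 j) * t + t ^+ 2) p d) _.
have -> : enorm x ^+ 2 + (2 * x 0 j) * 0 + 0 ^+ 2 = enorm x ^+ 2.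
  by rewrite mulr0 expr0n !addr0.
rewrite sqrtr_sqr ger0_norm ?enorm_ge0//; field.
by rewrite gt_eqF.
Qed.

Lemma line0 j (t : R) : enorm (t *: delta_mx 0 j + 0 : 'rV[R]_N) = `|t|.
Proof. by rewrite addr0 enormZ enorm_delta mulr1. Qed.

(** Along a coordinate axis through the origin the function is [v] itself, because [v] is even; away
    from the origin this is the chain rule. *)
Lemma is_derive_radial v dv x j : (forall r, v (- r) = v r) ->
  (forall r : R, is_derive r 1 v (dv r)) -> dv 0 = 0 ->
  is_derive x (delta_mx 0 j) (fun y => v (enorm y)) (dv (enorm x) / enorm x * x 0 j).
Proof.
move=> ve dvP dv0; apply: is_derive_line.
have [->|x0] := eqVneq x 0.
  have -> : (fun t : R => v (enorm (t *: delta_mx 0 j + 0 : 'rV[R]_N))) = v.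
    by apply/funext => t; rewrite line0; case: (ger0P t).
  by rewrite mxE mulr0 -[X in is_derive _ _ _ X]dv0; exact: dvP.
rewrite -mulrA [_^-1 * _]mulrC; apply: (is_derive_comp (f := v)).
  by rewrite scale0r add0r; exact: dvP.
exact: is_derive_enorm_line.
Qed.

Definition radial_field w i x : R := w (enorm x) / enorm x * x 0 i.

(** The continuous extension to 0 of [w r / r] for [w] odd with derivative [dw]. *)
Definition slope w dw (r : R) : R := if r == 0 then dw 0 else w r / r.

(** The Jacobian of [w(r) x / r], with eigenvalue [dw] in the radial direction and [slope] in the
    tangential ones. At the origin the second term is 0. *)
Definition radial_jac w dw i j x : R :=
  slope w dw (enorm x) * (i == j)%:R +
  x 0 i * x 0 j / enorm x ^+ 2 * (dw (enorm x) - slope w dw (enorm x)).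

Lemma is_derive_radial_field w dw i j x : (forall r, w (- r) = - w r) ->
  (forall r : R, is_derive r 1 w (dw r)) ->
  is_derive x (delta_mx 0 j) (radial_field w i) (radial_jac w dw i j x).
Proof.
move=> wo dwP; apply: is_derive_line; rewrite /radial_jac /slope enorm_eq0.
have w0 : w 0 = 0 by have := wo 0; rewrite oppr0; lra.
have [->|x0] := eqVneq x 0.
  rewrite mxE !mul0r addr0 (_ : (fun t => _) = fun t => w t * (i == j)%:R).
    rewrite mulrC (_ : (fun t => _) = fun t => (i == j)%:R * w t).
      exact: is_derive_scale.
    by apply/funext => t; rewrite mulrC.
  apply/funext => t; rewrite /radial_field line0 line_coord mxE addr0 mulrA.
  congr (_ * _); case: (ger0P t) => [|t0].
    by rewrite le_eqVlt => /orP[/eqP <-|t0]; rewrite ?mulr0 ?w0// divfK// gt_eqF.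
  by rewrite wo invrN mulrNN divfK// lt_eqF.
have r0 := enorm_gt0 x0.
have dr := is_derive_enorm_line j x0.
have e0 : enorm (0 *: delta_mx 0 j + x) = enorm x by rewrite scale0r add0r.
have d1 : is_derive (0 : R) 1 (fun t => w (enorm (t *: delta_mx 0 j + x)))
    (dw (enorm x) * (x 0 j / enorm x)).
  by apply: (is_derive_comp (f := w)) => //; rewrite e0; exact: dwP.
have d2 := is_derive_inv (f := fun t => enorm (t *: delta_mx 0 j + x)) _ dr.
rewrite e0 in d2; have {}d2 := d2 (lt0r_neq0 r0).
have d3 : is_derive (0 : R) 1 (fun t => (t *: delta_mx 0 j + x) 0 i) ((i == j)%:R).
  rewrite (_ : (fun t => _) = fun t : R => (i == j)%:R * t + x 0 i).
    rewrite -[X in is_derive _ _ _ X]addr0 -[X in is_derive _ _ _ (X + _)]mulr1.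
    by apply: is_derive_add; apply: is_derive_scale.
  by apply/funext => t; rewrite line_coord mulrC.
apply: is_derive_eq (is_derive_mul (is_derive_mul d1 d2) d3) _.
rewrite e0 scale0r add0r; field.
by rewrite gt_eqF.
Qed.

Lemma slope_continuous w dw : w 0 = 0 -> (forall r : R, is_derive r 1 w (dw r)) ->
  continuous (slope w dw).
Proof.
move=> w0 dwP r; have [->|r0] := eqVneq r 0.
  apply/cvgrPdist_le => e e0.
  have := quotient_is_derive (dwP 0).
  move=> /cvgrPdist_le/(_ e e0)/nbhs_ballP[d /= d0 hd]; apply/nbhs_ballP.
  exists d => //= s sd; rewrite /slope eqxx; case: eqVneq => [_|s0].
    by rewrite subrr normr0 ltW.
  by have := hd s sd s0; rewrite addr0 w0 subr0 mulrC.
have near_r : \forall s \near r, w s / s = slope w dw s.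
  near=> s; rewrite /slope ifF//; apply/negbTE; near: s; exact: (@open_neq _ _).
rewrite /continuous_at /slope (negPf r0).
apply: cvg_trans (near_eq_cvg near_r) _.
apply: cvgM; first exact: is_derive_continuous (dwP r).
by apply: cvgV => //; exact: cvg_id.
Unshelve. all: by end_near. Qed.

(** Directional factors such as [x_i / |x|] may have no limit at the origin, but they are bounded
    and multiplied by something that vanishes there. *)
Lemma bounded_mul_radial_continuous (phi : 'rV[R]_N -> R) h :
  (forall x, `|phi x| <= 1) -> (forall x, x != 0 -> {for x, continuous phi}) ->
  continuous h -> h 0 = 0 -> continuous (fun x => phi x * h (enorm x)).
Proof.
move=> phi1 cphi ch h0; move=> x.
have chr : {for x, continuous (fun y => h (enorm y))}.
  by apply: continuous_comp; [exact: enorm_continuous|exact: ch].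
have [x0|x0] := eqVneq x 0; last by apply: continuousM => //; exact: (cphi x x0).
apply/row_continuousP => e e0.
move/row_continuousP/(_ e e0) : chr; apply: filterS => y.
rewrite x0 enorm0 h0 mulr0 !sub0r !normrN normrM; apply: le_trans.
by rewrite ler_piMl.
Qed.

Let inv_enorm_continuous x : x != 0 -> {for x, continuous (fun y => (enorm y)^-1)}.
Proof.
by move=> x0; apply: continuousV; [rewrite enorm_eq0|exact: enorm_continuous].
Qed.

Let ratio1 x i : `|x 0 i / enorm x| <= 1.
Proof.
have [->|x0] := eqVneq x 0; first by rewrite mxE mul0r normr0 ler01.
rewrite normrM normfV (ger0_norm (enorm_ge0 x)) ler_pdivrMr ?enorm_gt0// mul1r.
exact: coord_le_enorm.
Qed.

Let ratio1_continuous i x : x != 0 -> {for x, continuous (fun y => y 0 i / enorm y)}.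
Proof.
by move=> x0; apply: continuousM; [exact: coord_continuous|exact: inv_enorm_continuous].
Qed.

Let ratio2E i j x : x 0 i * x 0 j / enorm x ^+ 2 = (x 0 i / enorm x) * (x 0 j / enorm x).
Proof. by rewrite mulrACA -invfM -expr2. Qed.

Let ratio2 i j x : `|x 0 i * x 0 j / enorm x ^+ 2| <= 1.
Proof. by rewrite ratio2E normrM mulr_ile1. Qed.

Lemma radial_field_continuous w i : continuous w -> w 0 = 0 ->
  continuous (radial_field w i).
Proof.
move=> cw w0; have -> : radial_field w i = fun x => x 0 i / enorm x * w (enorm x).
  by apply/funext => x; rewrite /radial_field; ring.
apply: (bounded_mul_radial_continuous (phi := fun x => x 0 i / enorm x)) => // x.
exact: ratio1_continuous.
Qed.

Lemma radial_jac_continuous w dw i j : w 0 = 0 ->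
  (forall r : R, is_derive r 1 w (dw r)) -> continuous dw ->
  continuous (radial_jac w dw i j).
Proof.
move=> w0 dwP cdw; have cs := slope_continuous w0 dwP.
move=> x; apply: row_continuousD.
  apply: continuousM; last exact: cst_continuous.
  by apply: continuous_comp; [exact: enorm_continuous|exact: cs].
apply: (bounded_mul_radial_continuous (h := fun r => dw r - slope w dw r) (ratio2 i j)) => [y y0|r|].
- rewrite (_ : (fun y => _) = fun y => (y 0 i / enorm y) * (y 0 j / enorm y)).
    by apply: continuousM; exact: ratio1_continuous.
  by apply/funext => z; exact: ratio2E.
- by apply: cvgB; [exact: cdw|exact: cs].
- by rewrite /slope eqxx subrr.
Qed.

Lemma vanishes_radial f (F : 'rV[R]_N -> R) : decaying f ->
  (forall x, `|F x| <= `|f (enorm x)|) -> vanishes_at_infinity F.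
Proof.
move=> df Ff e /df[A fA]; exists A => x Ax.
by apply: le_lt_trans (Ff x) _; apply: fA; exact: ltW.
Qed.

Lemma vanishes_radial_field w i : decaying w -> vanishes_at_infinity (radial_field w i).
Proof.
move=> dw; apply: (vanishes_radial dw) => x.
rewrite /radial_field -mulrA [_^-1 * _]mulrC normrM ler_piMr//.
Qed.

Lemma vanishes_radial_jac w dw i j : decaying w -> decaying dw ->
  vanishes_at_infinity (radial_jac w dw i j).
Proof.
move=> decw decdw e e0; have e3 : 0 < e / 3 by rewrite divr_gt0.
have [A1 h1] := decw _ e3; have [A2 h2] := decdw _ e3.
exists (Num.max 1 (Num.max A1 A2)) => x; rewrite !gt_max => /and3P[r1 rA1 rA2].
have r0 : 0 < enorm x by rewrite (lt_trans ltr01).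
have s1 : `|slope w dw (enorm x)| < e / 3.
  rewrite /slope gt_eqF// normrM normfV (gtr0_norm r0) ltr_pdivrMr//.
  apply: lt_le_trans (h1 _ (ltW rA1)) _; rewrite ler_peMr// ltW//.
have s2 := h2 _ (ltW rA2).
apply: le_lt_trans (ler_normD _ _) _; rewrite !normrM.
have b1 : `|slope w dw (enorm x)| * `|(i == j)%:R : R| <= `|slope w dw (enorm x)|.
  by rewrite ler_piMr// normr_nat lern1 leq_b1.
have b2 := ler_normB (dw (enorm x)) (slope w dw (enorm x)).
have b3 : `|x 0 i| * `|x 0 j| * `|(enorm x ^+ 2)^-1| *
    `|dw (enorm x) - slope w dw (enorm x)| <= `|dw (enorm x) - slope w dw (enorm x)|.
  by rewrite ler_piMl// -!normrM ratio2.
have -> : e = e / 3 + e / 3 + e / 3 by field.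
lra.
Qed.

End Radial.

(** * A cube is not Lebesgue negligible *)

Section CubeCover.
Variable R : realType.
Local Notation mu := (@lebesgue_measure R).

(** The box volume with sides indexed by [nat], so that the induction on the dimension can split off
    the last coordinate. *)
Definition side_prod (m : nat) (A B : nat -> R) : R :=
  \prod_(i < m) Num.max 0 (B i - A i).

Lemma side_prod_ge0 m A B : 0 <= side_prod m A B.
Proof. by apply: prodr_ge0 => i _; rewrite le_max lexx. Qed.

Lemma lebesgue_measure_segment (a b : R) : mu `[a, b] = (Num.max 0 (b - a))%:E.
Proof.
rewrite lebesgue_measure_itv/= lte_fin; case: ltP => ab.
  by rewrite -EFinB max_r// subr_ge0 ltW.
by rewrite max_l// subr_le0.
Qed.

(* Induction on the dimension: by the induction hypothesis the slice of the
   covering at height [t] has total volume at least [(d - c) ^+ m], and this is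
   integrated over [t]. The selection [S] of the boxes that meet a slice is part
   of the induction. *)
Lemma cube_cover_volume (m : nat) (A B : nat -> nat -> R) (S : nat -> bool) (c d : R) :
  c <= d ->
  (forall x : nat -> R, (forall i, (i < m)%N -> c <= x i <= d) ->
     exists2 k, S k & forall i, (i < m)%N -> A k i <= x i <= B k i) ->
  (((d - c) ^+ m)%:E <= \sum_(0 <= k <oo) ((S k)%:R * side_prod m (A k) (B k))%:E)%E.
Proof.
move=> cd; elim: m S => [|m IH] S cover.
  (* In dimension 0 every box has volume 1, so one selected box suffices. *)
  have [k Sk _] := cover (fun=> c) (fun i (h : (i < 0)%N) => False_ind _ (notF h)).
  apply: le_trans (nneseries_lim_ge k.+1 _); last first.
    by move=> n _ _; rewrite lee_fin mulr_ge0// side_prod_ge0.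
  rewrite big_nat_recr//= Sk /side_prod big_ord0 mulr1 expr0.
  rewrite leeDr//; apply: sume_ge0 => i _.
  by rewrite lee_fin big_ord0 mulr1.
(* The volume of the slice of box [k] at height [t]; its integral over [[c, d]] is at most the
   volume of the box. *)
pose f k (t : measurableTypeR R) : \bar R :=
  (((S k)%:R * side_prod m (A k) (B k))%:E * (\1_`[A k m, B k m] t)%:E)%E.
have f0 k t : (0 <= f k t)%E.
  by rewrite mule_ge0// lee_fin ?mulr_ge0// side_prod_ge0.
pose D : set (measurableTypeR R) := `[c, d]%classic.
have mf k : measurable_fun D (f k).
  apply: measurable_funeM; apply/measurable_EFinP.
  exact: measurable_indic.
have slice t : t \in `[c, d] -> (((d - c) ^+ m)%:E <= \sum_(0 <= k <oo) f k t)%E.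
  rewrite in_itv/= => tcd.
  apply: le_trans (IH (fun k => S k && (A k m <= t <= B k m)) _) _.
    move=> x xcd; pose y i := if i == m then t else x i.
    have [i im|k Sk ky] := cover y.
      rewrite /y; case: eqVneq => // im'; apply: xcd.
      by rewrite ltn_neqAle im' -ltnS.
    exists k => [|i im]; first by have := ky m (ltnSn m); rewrite /y eqxx Sk.
    by have := ky i (ltnW im); rewrite /y ltn_eqF.
  apply: lee_nneseries => k _; first by rewrite lee_fin mulr_ge0// side_prod_ge0.
  rewrite /f -EFinM lee_fin indicE mem_setE in_itv/=.
  by case: (S k); case: (_ <= t <= _); rewrite /= ?mul0r ?mulr0 ?mul1r ?mulr1 ?side_prod_ge0.
have mD : measurable D by exact: measurable_itv.
have -> : ((d - c) ^+ m.+1)%:E = (\int[mu]_(t in D) ((d - c) ^+ m)%:E)%E.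
  transitivity (((d - c) ^+ m)%:E * mu `[c, d])%E; last by rewrite integral_cst.
  by rewrite lebesgue_measure_segment max_r ?subr_ge0// -EFinM exprSr.
apply: (@le_trans _ _ (\int[mu]_(t in D) \sum_(0 <= k <oo) f k t)%E).
  apply: ge0_le_integral => //.
  - by move=> t _; rewrite lee_fin exprn_ge0// subr_ge0.
  - by apply: ge0_emeasurable_sum.
rewrite integral_nneseries//; apply: lee_nneseries => k _.
  by move=> _; apply: integral_ge0 => t _; exact: f0.
rewrite ge0_integralZl_EFin//; last 2 first.
- by apply/measurable_EFinP; exact: measurable_indic.
- by rewrite mulr_ge0// side_prod_ge0.
rewrite integral_indic//= /side_prod big_ord_recr/= -/(side_prod m (A k) (B k)).
rewrite mulrA [leRHS]EFinM; apply: lee_wpmul2l; first by rewrite lee_fin mulr_ge0// side_prod_ge0.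
rewrite -lebesgue_measure_segment; apply: le_measure; rewrite ?inE//.
by apply: measurableI.
Qed.

Lemma cube_not_null (n : nat) (d : R) (A : set 'rV[R]_n.+1) : 0 < d ->
  (forall x : 'rV[R]_n.+1, (forall i, `|x 0 i| <= d) -> A x) -> ~ lebesgue_null A.
Proof.
move=> d0 dA null.
have v0 : 0 < (d - - d) ^+ n.+1 by rewrite exprn_gt0// opprK addr_gt0.
have [|a [b [Aab vol]]] := null ((d - - d) ^+ n.+1 / 2); first by rewrite divr_gt0.
have := @cube_cover_volume n.+1 (fun k i => a k 0 (inord i)) (fun k i => b k 0 (inord i))
  (fun=> true) (- d) d.
have -> : (\sum_(0 <= k <oo) (true%:R * side_prod n.+1 (fun i => a k 0 (inord i))
    (fun i => b k 0 (inord i)))%:E = \sum_(0 <= k <oo) (box_volume (a k) (b k))%:E)%E.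
  apply: eq_eseriesr => k _; rewrite mul1r; congr EFin.
  by apply: eq_bigr => i _; rewrite inord_val.
move=> cover; have : (((d - - d) ^+ n.+1)%:E <= ((d - - d) ^+ n.+1 / 2)%:E)%E.
  apply: le_trans vol; apply: cover; first by lra.
  move=> x xd; have [|k _ xk] := Aab (\row_i x i).
    by apply: dA => i; rewrite mxE ler_norml xd.
  exists k => // i im; have := xk (inord i); rewrite mxE inordK//.
by rewrite lee_fin ler_pdivlMr//; lra.
Qed.

(** By continuity [|u|] exceeds any [y < M] on a cube about 0, which is not negligible. *)
Lemma Linfty_norm_peak (n : nat) (u : 'rV[R]_n.+1 -> R) (M : R) :
  continuous u -> (forall x, `|u x| <= M) -> `|u 0| = M -> Linfty_norm u = M%:E.
Proof.
move=> cu uM u0; apply/eqP; rewrite eq_le; apply/andP; split.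
  (* For [y = M] the exceptional set is empty and degenerate boxes cover it; their volume is 0
     because the dimension is positive. *)
  apply: ereal_inf_lbound => e e0 /=; exists (fun=> 0), (fun=> 0); split.
    by move=> x /=; rewrite lee_fin uM.
  rewrite eseries0 ?lee_fin ?(ltW e0)// => k _ _.
  by rewrite /box_volume big_ord_recl mxE subrr maxxx mul0r.
apply: le_ereal_inf_tmp => y /= null; rewrite leNgt; apply/negP => yM.
have [d d0 hd] : exists2 d : R, 0 < d & forall x : 'rV[R]_n.+1,
    (forall i, `|x 0 i| < d) -> (y < `|u x|%:E)%E.
  case: y yM null => [r| |] yM _ //; last by exists 1 => // x _; rewrite ltNyr.
  rewrite lte_fin in yM.
  have Mr : 0 < (M - r) by rewrite subr_gt0.
  have /nbhs_ballP[d /= d0 hd] : \forall x \near (0 : 'rV[R]_n.+1), `|u 0 - u x| <= (M - r) / 2.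
    by apply: (proj2 (row_continuousP _ _)); [exact: cu|rewrite divr_gt0].
  exists d => // x xd; rewrite lte_fin.
  have : `|u 0 - u x| <= (M - r) / 2.
    by apply: hd; split=> // i j; rewrite /ball/= mxE sub0r normrN ord1.
  have := lerB_dist (u 0) (u x); rewrite u0; lra.
apply: (@cube_not_null n (d / 2) _ _ _ null); first by rewrite divr_gt0.
move=> x xd; apply/negP; rewrite -ltNge; apply: hd => i.
by apply: le_lt_trans (xd i) _; lra.
Qed.

End CubeCover.

(** * Radial profiles solve the equation *)

Section ProfileSolution.
Variables (R : realType) (n : nat) (g v P dP : R -> R).
Hypothesis prof : radial_profile n g v P dP.
Local Notation V := 'rV[R]_n.+1.

Let W (r : R) : R := psi (P r).
Let dW (r : R) : R := dpsi (P r) * dP r.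
Let u (x : V) : R := v (enorm x).

Let v_even r : v (- r) = v r. Proof. by case: prof => [[]]. Qed.
Let P_odd r : P (- r) = - P r. Proof. by case: prof => [[]]. Qed.
Let dv (r : R) : is_derive r 1 v (W r). Proof. by case: prof => [_ []]. Qed.
Let dPP (r : R) : is_derive r 1 P (dP r). Proof. by case: prof => [_ []]. Qed.
Let cdP : continuous dP. Proof. by case: prof. Qed.
Let P0 : P 0 = 0. Proof. by have := P_odd 0; rewrite oppr0; lra. Qed.
Let W0 : W 0 = 0. Proof. by rewrite /W P0 psi0. Qed.
Let W_odd r : W (- r) = - W r. Proof. by rewrite /W P_odd psiN. Qed.
Let cv : continuous v. Proof. by move=> r; exact: is_derive_continuous (dv r). Qed.
Let cP : continuous P. Proof. by move=> r; exact: is_derive_continuous (dPP r). Qed.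

Let dWP (r : R) : is_derive r 1 W (dW r).
Proof. exact: (is_derive_comp (is_derive_psi (P r)) (dPP r)). Qed.

Let cW : continuous W. Proof. by move=> r; exact: is_derive_continuous (dWP r). Qed.

Let cdW : continuous dW.
Proof.
move=> r; apply: cvgM; last exact: cdP.
by apply: continuous_comp; [exact: cP|exact: dpsi_continuous].
Qed.

Lemma pderiv_profile i : pderiv i u = radial_field W i.
Proof.
apply/funext => x; have d := is_derive_radial x i v_even dv W0.
by rewrite /pderiv; exact: derive_val.
Qed.

Lemma pderiv_radial_field w dw (i j : 'I_n.+1) : (forall r, w (- r) = - w r) ->
  (forall r : R, is_derive r 1 w (dw r)) ->
  pderiv j (radial_field w i) = radial_jac w dw i j.
Proof.
move=> wo dwP; apply/funext => x; have d := is_derive_radial_field i j x wo dwP.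
by rewrite /pderiv; exact: derive_val.
Qed.

Let u_continuous : continuous u.
Proof. by move=> x; apply: continuous_comp; [exact: enorm_continuous|exact: cv]. Qed.

Lemma profile_C2 : C2 u.
Proof.
split.
  split=> [|i]; first exact: u_continuous.
  rewrite pderiv_profile; split; last exact: radial_field_continuous.
  by move=> x; have [] := is_derive_radial x i v_even dv W0.
move=> i; rewrite pderiv_profile; split=> [|j]; first exact: radial_field_continuous.
rewrite (pderiv_radial_field i j W_odd dWP); split; last exact: radial_jac_continuous.
by move=> x; have [] := is_derive_radial_field i j x W_odd dWP.
Qed.

Lemma grad_profile x : grad u x = (W (enorm x) / enorm x) *: x.
Proof. by apply/rowP => i; rewrite !mxE pderiv_profile. Qed.

Lemma enorm_grad_profile x : enorm (grad u x) = `|W (enorm x)|.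
Proof.
rewrite grad_profile enormZ; have [->|x0] := eqVneq x 0.
  by rewrite enorm0 W0 mulr0 normr0.
by rewrite normrM normfV (ger0_norm (enorm_ge0 x)) divfK// enorm_eq0.
Qed.

(** [1 - psi(P)^2 = 1 / (1 + P^2)], so normalising the gradient undoes [psi] and leaves the field of
    [P]. *)
Lemma flux_profile i :
  (fun y => ((Num.sqrt (1 - enorm (grad u y) ^+ 2))^-1 *: grad u y) 0 i) =
  radial_field P i.
Proof.
apply/funext => x; rewrite enorm_grad_profile grad_profile !mxE /radial_field.
rewrite real_normK ?num_real//; set r := enorm x.
have s0 := sqrt1D_gt0 (P r); have s2 := sqr_sqrt1D (P r).
have -> : 1 - W r ^+ 2 = (Num.sqrt (1 + P r ^+ 2))^-1 ^+ 2.
  rewrite /W /psi; move: s0 s2; set s := Num.sqrt _ => s0 s2.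
  have -> : (P r / s) ^+ 2 = (s ^+ 2 - 1) / s ^+ 2.
    by rewrite s2 addrAC subrr add0r -s2 expr_div_n.
  by field; rewrite gt_eqF.
rewrite sqrtr_sqr gtr0_norm ?invr_gt0// invrK /W /psi mulrA; congr (_ * _).
rewrite mulrA; congr (_ / _); rewrite mulrCA divff ?mulr1//.
by rewrite gt_eqF.
Qed.

(** The trace of the Jacobian is [(n + 1) slope + (dP - slope)], that is [dP + n P / r] away from
    the origin and [(n + 1) dP 0] at it. *)
Lemma divergence_profile x :
  - divergence (fun y => (Num.sqrt (1 - enorm (grad u y) ^+ 2))^-1 *: grad u y) x =
  g (u x).
Proof.
case: prof => [_ _ _ eq eq0]; rewrite /divergence.
under eq_bigr => i _ do rewrite flux_profile (pderiv_radial_field i i P_odd dPP).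
rewrite /radial_jac big_split/= -mulr_sumr -mulr_suml -mulr_suml.
under eq_bigr => i _ do rewrite eqxx.
under [X in _ + X / _ * _]eq_bigr => i _ do rewrite -expr2.
rewrite sumr_const card_ord -sqr_enorm /slope enorm_eq0 /u.
have [->|x0] := eqVneq x 0.
  by rewrite enorm0 subrr mulr0 addr0 mulrC eq0 opprK.
rewrite divff ?mul1r ?expf_neq0 ?enorm_eq0// eq ?enorm_eq0// -natr1.
by ring.
Qed.

Theorem profile_is_solution : is_solution g u.
Proof.
split; [exact: profile_C2| |exact: divergence_profile].
by move=> x; rewrite enorm_grad_profile psi_lt1.
Qed.

Lemma profile_localized : decaying v -> decaying P -> decaying dP -> localized u.
Proof.
move=> decv decP decdP.
have decW : decaying W.
  move=> e /decP[A hA]; exists A => r Ar; apply: le_lt_trans (hA _ Ar).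
  by have := psi_lipschitz (P r) 0; rewrite psi0 !subr0.
have decdW : decaying dW.
  move=> e /decdP[A hA]; exists A => r Ar; apply: le_lt_trans (hA _ Ar).
  by rewrite normrM ler_piMl// gtr0_norm ?dpsi_gt0// dpsi_le1.
split=> [|i|i j]; first exact: (vanishes_radial decv).
- by rewrite pderiv_profile; exact: vanishes_radial_field.
- by rewrite pderiv_profile (pderiv_radial_field i j W_odd dWP); exact: vanishes_radial_jac.
Qed.

Lemma profile_oscillating : (forall A, exists2 r, A < r & v r = 0) -> oscillating u.
Proof.
move=> zeros; pose e : V := delta_mx 0 0.
have /choice[r rP] (k : nat) : exists r, k%:R < r /\ v r = 0.
  by have [r kr vr] := zeros k%:R; exists r.
exists (fun k => r k *: e); split=> [k|M].
  have [kr vr] := rP k.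
  rewrite /u enormZ enorm_delta mulr1 gtr0_norm//.
  exact: le_lt_trans kr.
exists (Num.bound `|M|); have [kr _] := rP (Num.bound `|M|).
rewrite enormZ enorm_delta mulr1; apply: le_lt_trans (ler_norm M) _.
apply: lt_trans (archi_boundP (normr_ge0 M)) _.
by apply: lt_le_trans kr _; exact: ler_norm.
Qed.

End ProfileSolution.

Lemma profile_periodic (R : realType) (v : R -> R) (T : R) :
  (forall r, v (- r) = v r) -> 0 < T -> (forall r, v (r + T) = v r) ->
  exists T' : 'rV[R]_1, T' != 0 /\ periodic (fun x : 'rV[R]_1 => v (enorm x)) T'.
Proof.
move=> ve T0 vT; exists (const_mx T); split.
  by apply/eqP => /rowP/(_ 0); rewrite !mxE => T00; move: T0; rewrite T00 ltxx.
have vE (x : 'rV[R]_1) : v (enorm x) = v (x 0 0).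
  rewrite /enorm big_ord1 sqrtr_sqr.
  by case: (ger0P (x 0 0)).
by move=> x; rewrite !vE !mxE vT.
Qed.

Theorem theorem1p3 (R : realType) (N : nat) (hN : (1 <= N)%N)
  (g : R -> R)
  (g1 : continuous g)
  (g2 : forall s : R, g (- s) = - g s)
  (alpha : \bar R) (halpha : (0 < alpha)%E)
  (g3pos : forall s : R, 0 < s -> (s%:E < alpha)%E -> 0 < g s)
  (g3neg : forall s : R, (alpha < s%:E)%E -> g s < 0)
  (g4 : (2 <= N)%N -> derivable g 0 1 /\ 0 < derive1 g 0)
  (xi : R) (hxi : (`|xi|%:E < alpha)%E) :
  exists u : 'rV[R]_N -> R,
    [/\ is_solution g u,
        oscillating u,
        u 0 = xi,
        Linfty_norm u = `|xi|%:E &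
        (N = 1%N -> exists T : 'rV[R]_N, T != 0 /\ periodic u T) /\
        ((2 <= N)%N -> localized u)].
Proof.
case: N hN g4 => // n _ g4.
have g0 : g 0 = 0 by have := g2 0; rewrite oppr0; lra.
have [v [P [dP [prof [v0 v_le] zeros per dec]]]] : exists v P dP : R -> R,
    [/\ radial_profile n g v P dP,
        v 0 = xi /\ (forall r, `|v r| <= `|xi|),
        forall A, exists2 r, A < r & v r = 0,
        n = 0%N -> exists2 T, 0 < T & forall r, v (r + T) = v r &
        (0 < n)%N -> [/\ decaying v, decaying P & decaying dP]].
  (* For [xi = 0] the zero function is the solution; the energy argument needs a positive height,
     and negative heights follow by the oddness of [g]. *)
  have [->|xi0] := eqVneq xi 0.
    exists (fun=> 0), (fun=> 0), (fun=> 0); split.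
    - split; first by split=> r; rewrite ?oppr0.
      + by split=> r; rewrite ?psi0; exact: is_derive_cst.
      + by move=> r; exact: cvg_cst.
      + by move=> r _; rewrite g0 mul0r mulr0 subr0 oppr0.
      + by rewrite g0 mulr0 oppr0.
    - by [].
    - by move=> A; exists (A + 1); rewrite ?ltrDl.
    - by move=> _; exists 1.
    - by move=> _; split=> e e0; exists 0 => r _; rewrite normr0.
  have gp s : 0 < s <= `|xi| -> 0 < g s.
    move=> /andP[s0 sxi]; apply: g3pos => //.
    by apply: le_lt_trans hxi; rewrite lee_fin.
  have xin : 0 < `|xi| by rewrite normr_gt0.
  have [v [P [dP [prof [v0 v_le] zeros per dec]]]] :=
    oscillating_profile_exists xin g1 g2 gp g4.
  have [xip|xip] := leP 0 xi.
    by exists v, P, dP; split=> //; split=> //; rewrite v0 ger0_norm.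
  exists (fun r => - v r), (fun r => - P r), (fun r => - dP r).
  have decN f : decaying f -> decaying (fun r => - f r).
    by move=> df e /df[A fA]; exists A => r /fA; rewrite normrN.
  split; first exact: radial_profile_opp.
  - by split=> [|r]; rewrite ?normrN// v0 ltr0_norm// opprK.
  - by move=> A; have [r Ar vr] := zeros A; exists r => //; rewrite vr oppr0.
  - by move=> /per[T T0 vT]; exists T => // r; rewrite vT.
  - by move=> /dec[d1 d2 d3]; split; exact: decN.
have [[ve _] [dv _] _ _ _] := prof.
exists (fun x => v (enorm x)); split.
- exact: (profile_is_solution prof).
- exact: profile_oscillating.
- by rewrite enorm0.
- apply: Linfty_norm_peak => [|x|]; rewrite ?enorm0 ?v0//.
  move=> x; apply: continuous_comp; first exact: enorm_continuous.
  exact: is_derive_continuous (dv _).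
split=> [n1|n2].
  case: n1 => n0; have [T T0 vT] := per n0.
  by move: {prof dec per g4} n0 => ->; exact: (profile_periodic ve T0 vT).
have [d1 d2 d3] := dec n2.
exact: (profile_localized prof).
Qed.
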